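(* For $n=4$ and for $n=6$, the free spectrahedron $\mathcal D_{F^{[3]}}$ has a free extreme point at level $n$. Consequently $\mathcal D_{F^{[3]}}$ is not the minimal matrix convex set over its first level (the closed unit ball $\overline{\mathbb B_3}$), and $\mathcal W(F^{[3]})$ is not the maximal matrix convex set over $\overline{\mathbb B_3}$. Explicitly, for a tuple $C=(C_1,C_2,C_3)$ of complex symmetric $(n/2)\times(n/2)$ matrices put $$X=\left(\begin{bmatrix}0&C_1\\ \overline{C_1}&0\end{bmatrix},\begin{bmatrix}0&C_2\\ \overline{C_2}&0\end{bmatrix},\begin{bmatrix}0&C_3\\ \overline{C_3}&0\end{bmatrix}\right)\in SM_n(\mathbb C)^3.$$ For $n=4$ and $C=\tfrac12\left(\begin{bmatrix}1+\tfrac1{\sqrt3}&0\\0&-1+\sqrt3\end{bmatrix},\begin{bmatrix}0&1\\1&0\end{bmatrix},\begin{bmatrix}-i+\tfrac{2i}{\sqrt3}&0\\0&-i\end{bmatrix}\right)$, and for $n=6$ with $\alpha=\sqrt2-1$ and $C_1=\tfrac14\begin{bmatrix}\alpha+1&0&-\alpha\\0&\alpha+1&-\alpha\\-\alpha&-\alpha&\alpha+1\end{bmatrix}$, $C_2=\tfrac14\begin{bmatrix}-4\sqrt{2\alpha}&0&0\\0&4\sqrt{2\alpha}&0\\0&0&0\end{bmatrix}$, $C_3=\tfrac{i}4\begin{bmatrix}0&3\alpha-1&\alpha\\3\alpha-1&0&\alpha\\\alpha&\alpha&3-\alpha\end{bmatrix}$, the tuple $X$ belongs to $\mathcal D_{F^{[3]}}(n)$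 and is a free extreme point of $\mathcal D_{F^{[3]}}$.
   Context: $F^{[3]}=(\sigma_z\otimes\sigma_z,\sigma_x\otimes\sigma_z,I_2\otimes\sigma_x)$ with $\sigma_z=\begin{bmatrix}1&0\\0&-1\end{bmatrix}$, $\sigma_x=\begin{bmatrix}0&1\\1&0\end{bmatrix}$ (pairwise anticommuting self-adjoint unitaries). For a self-adjoint matrix tuple $A$, $\mathcal D_A=\bigcup_n\mathcal D_A(n)$, $\mathcal D_A(n)=\{X\in SM_n(\mathbb C)^g: I-\sum_iA_i\otimes X_i\succeq0\}$; the matrix range $\mathcal W(A)$ is the set of all images $\phi(A)$ under unital completely positive maps into matrix algebras. A matrix convex set is a graded set closed under matrix convex combinations $\sum_iV_i^*X^{(i)}V_i$ with $\sum_iV_i^*V_i=I$. A point $X\in K(n)$ is a free extreme point of a matrix convex set $K$ if whenever $X=\sum_iV_i^*X^{(i)}V_i$ is a matrix convex combination of points of $K$ with all $V_i\ne0$, each $X^{(i)}$ is unitarily equivalent to $X$ or to $X\oplus Z$ for some $Z\in K$. For compact convex $C\subseteq\mathbb R^g$, the minimal (maximal) matrix convex set over $C$ is the smallest (largest) matrix convex set whose first level equals $C$. $\overline{C_j}$ denotes entrywise complex conjugation. *)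

(* Defs.v *)
From HB Require Import structures.
From mathcomp Require Import all_boot all_order all_algebra.
From mathcomp Require Import reals.
From mathcomp Require Import complex mxtens.

Set Implicit Arguments.
Unset Strict Implicit.
Unset Printing Implicit Defensive.

Import Order.TTheory GRing.Theory Num.Theory.
Local Open Scope ring_scope.

Section FreeConvexity.
Variable R : realType.
Local Notation C := R[i].

Definition adj m n (A : 'M[C]_(m, n)) : 'M[C]_(n, m) := (map_mx (@conjc R) A)^T.

Definition hermitian n (A : 'M[C]_n) : Prop := adj A = A.

Definition psd n (A : 'M[C]_n) : Prop :=
  hermitian A /\ forall v : 'cV[C]_n, 0 <= (adj v *m A *m v) 0 0.

Definition gset (g : nat) := forall n : nat, ('I_g -> 'M[C]_n) -> Prop.

Definition sa_tuple g n (X : 'I_g -> 'M[C]_n) : Prop := forall j, hermitian (X j).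

Definition spectrahedron g d (A : 'I_g -> 'M[C]_d) : gset g :=
  fun n X => sa_tuple X /\ psd (1%:M - \sum_(j < g) (A j *t X j)).

Definition mconv_comb g n k (d : 'I_k -> nat) (V : forall i, 'M[C]_(d i, n))
  (Y : forall i, 'I_g -> 'M[C]_(d i)) : 'I_g -> 'M[C]_n :=
  fun j => \sum_(i < k) adj (V i) *m Y i j *m V i.

Definition isometric_family n k (d : 'I_k -> nat) (V : forall i, 'M[C]_(d i, n))
  : Prop := \sum_(i < k) adj (V i) *m V i = 1%:M.

Definition matrix_convex g (K : gset g) : Prop :=
  (forall n X, K n X -> sa_tuple X) /\
  (forall n k (d : 'I_k -> nat) (V : forall i, 'M[C]_(d i, n))
          (Y : forall i, 'I_g -> 'M[C]_(d i)),
      (forall i, K (d i) (Y i)) -> isometric_family V -> K n (mconv_comb V Y)).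

Definition unitary_equiv g p q (Y : 'I_g -> 'M[C]_p) (W : 'I_g -> 'M[C]_q) : Prop :=
  exists U : 'M[C]_(p, q),
    adj U *m U = 1%:M /\ U *m adj U = 1%:M /\ forall j, W j = adj U *m Y j *m U.

Definition dsum g p q (X : 'I_g -> 'M[C]_p) (Z : 'I_g -> 'M[C]_q)
  : 'I_g -> 'M[C]_(p + q) := fun j => block_mx (X j) 0 0 (Z j).

Definition free_extreme g (K : gset g) n (X : 'I_g -> 'M[C]_n) : Prop :=
  K n X /\
  forall k (d : 'I_k -> nat) (V : forall i, 'M[C]_(d i, n))
         (Y : forall i, 'I_g -> 'M[C]_(d i)),
    (forall i, V i != 0) -> (forall i, K (d i) (Y i)) -> isometric_family V ->
    X = mconv_comb V Y ->
    forall i, unitary_equiv (Y i) X \/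
              exists m (Z : 'I_g -> 'M[C]_m), K m Z /\ unitary_equiv (Y i) (dsum X Z).

Definition real_pt g (x : 'I_g -> R) : 'I_g -> 'M[C]_1 :=
  fun j => (real_complex R (x j))%:M.

Definition first_level_is g (K : gset g) (S : ('I_g -> R) -> Prop) : Prop :=
  forall X : 'I_g -> 'M[C]_1, K 1%N X <-> exists x, S x /\ X = real_pt x.

Definition is_min_over g (K : gset g) (S : ('I_g -> R) -> Prop) : Prop :=
  matrix_convex K /\ first_level_is K S /\
  forall K' : gset g, matrix_convex K' -> first_level_is K' S ->
    forall n X, K n X -> K' n X.

Definition is_max_over g (K : gset g) (S : ('I_g -> R) -> Prop) : Prop :=
  matrix_convex K /\ first_level_is K S /\
  forall K' : gset g, matrix_convex K' -> first_level_is K' S ->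
    forall n X, K' n X -> K n X.

Definition closed_ball3 (x : 'I_3 -> R) : Prop := \sum_(j < 3) x j ^+ 2 <= 1.

Definition lin_map d n (phi : 'M[C]_d -> 'M[C]_n) : Prop :=
  forall (a : C) A B, phi (a *: A + B) = a *: phi A + phi B.

Definition unital_map d n (phi : 'M[C]_d -> 'M[C]_n) : Prop := phi 1%:M = 1%:M.

(* complete positivity: the k-th ampliation id_k (x) phi, acting on
   sum_{p,q} E_pq (x) B_pq, preserves positive semidefiniteness for all k *)
Definition cp_map d n (phi : 'M[C]_d -> 'M[C]_n) : Prop :=
  forall k (B : 'I_k -> 'I_k -> 'M[C]_d),
    psd (\sum_(p < k) \sum_(q < k) (delta_mx p q *t B p q)) ->
    psd (\sum_(p < k) \sum_(q < k) (delta_mx p q *t phi (B p q))).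

Definition ucp_map d n (phi : 'M[C]_d -> 'M[C]_n) : Prop :=
  lin_map phi /\ unital_map phi /\ cp_map phi.

Definition matrix_range g d (A : 'I_g -> 'M[C]_d) : gset g :=
  fun n X => exists phi : 'M[C]_d -> 'M[C]_n, ucp_map phi /\ X = (fun j => phi (A j)).

Definition mx2 (a b c e : C) : 'M[C]_2 :=
  \matrix_(i < 2, j < 2) nth 0 (nth [::] [:: [:: a; b]; [:: c; e]] i) j.

Definition mx3 (a11 a12 a13 a21 a22 a23 a31 a32 a33 : C) : 'M[C]_3 :=
  \matrix_(i < 3, j < 3)
    nth 0 (nth [::] [:: [:: a11; a12; a13]; [:: a21; a22; a23];
                        [:: a31; a32; a33]] i) j.

Definition sigma_z : 'M[C]_2 := mx2 1 0 0 (-1).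
Definition sigma_x : 'M[C]_2 := mx2 0 1 1 0.

Definition F3 : 'I_3 -> 'M[C]_(2 * 2) := fun j =>
  if val j == 0%N then sigma_z *t sigma_z
  else if val j == 1%N then sigma_x *t sigma_z
  else 1%:M *t sigma_x.

Definition Xof m (Cs : 'I_3 -> 'M[C]_m) : 'I_3 -> 'M[C]_(m + m) :=
  fun j => block_mx 0 (Cs j) (map_mx (@conjc R) (Cs j)) 0.

Definition ci : C := Complex 0 1.
Definition rc (x : R) : C := real_complex R x.

Definition s3 : R := Num.sqrt 3.

Definition C4 : 'I_3 -> 'M[C]_2 := fun j =>
  if val j == 0%N then
    (rc (1/2)) *: mx2 (rc (1 + 1 / s3)) 0 0 (rc (-1 + s3))
  else if val j == 1%N then
    (rc (1/2)) *: mx2 0 1 1 0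
  else
    (rc (1/2)) *: mx2 (- ci + rc 2 * ci / rc s3) 0 0 (- ci).

Definition alpha : R := Num.sqrt 2 - 1.
Definition beta : R := Num.sqrt (2 * alpha).

Definition C6 : 'I_3 -> 'M[C]_3 := fun j =>
  let a := rc alpha in
  if val j == 0%N then
    (rc (1/4)) *: mx3 (a + 1) 0 (- a)
                      0 (a + 1) (- a)
                      (- a) (- a) (a + 1)
  else if val j == 1%N then
    (rc (1/4)) *: mx3 (- rc 4 * rc beta) 0 0
                      0 (rc 4 * rc beta) 0
                      0 0 0
  else
    (ci / rc 4) *: mx3 0 (rc 3 * a - 1) a
                       (rc 3 * a - 1) 0 a
                       a a (rc 3 - a).

Definition X4 : 'I_3 -> 'M[C]_(2 + 2) := Xof C4.
Definition X6 : 'I_3 -> 'M[C]_(3 + 3) := Xof C6.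

End FreeConvexity.

(* Main.v *)
Require Import Defs.
From Stdlib Require Import ZArith QArith.
From HB Require Import structures.
From mathcomp Require Import all_boot all_order all_algebra.
From mathcomp Require Import reals boolp.
From mathcomp Require Import complex mxtens.
From mathcomp Require Import ssrZ.
From mathcomp Require Import ring lra.
Set Implicit Arguments.
Unset Strict Implicit.
Unset Printing Implicit Defensive.

Import Order.TTheory GRing.Theory Num.Theory.
Local Open Scope nat_scope.
Local Open Scope ring_scope.

(* A self-adjoint dilation is controlled by the kernel of the pencil: if X is a
   matrix convex combination of Y_i with coefficients V_i, then 1 - sum F_j (x) Y_ij
   annihilates (1 (x) V_i) w for each w in the kernel of 1 - sum F_j (x) X_j, so
   sum_j (F_j (x) (Y_ij V_i - V_i X_j)) w = 0.  When this linear system has only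
   the zero solution, V_i intertwines X and Y_i; if moreover X has trivial
   commutant then V_i is a multiple of an isometry and Y_i splits as X + Z.
   For X4 and X6 the operator H = sum F_j (x) X_j has spectrum {1, a, -a, -1}, i.e.
   (1 - H^2)^2 = t (1 - H^2) with t = 1 - a^2 > 0, which gives both the positivity
   of 1 - H and a spanning set of its kernel; the identity and the two linear
   systems are decided by exact arithmetic in Q(sqrt 3, i) and Q(beta, i).
   A free extreme point at level n > 1 is never a compression of points of level
   1, hence the failure of minimality.  For the matrix range, a tuple Y of the
   polar of the ball such that 1 - sum X4_j (x) Y_j is not positive cannot be the
   image of F under a unital completely positive map. *)

(** * Adjoints, positive semidefinite matrices and the completion of isometries *)

Section Adjoint.
Variable R : realType.
Local Notation C := R[i].

Lemma adjE m n (A : 'M[C]_(m, n)) i j : adj A i j = Num.conj (A j i).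
Proof. by rewrite !mxE. Qed.

Lemma adjK m n (A : 'M[C]_(m, n)) : adj (adj A) = A.
Proof. by apply/matrixP => i j; rewrite !adjE conjCK. Qed.

Lemma adjM m n p (A : 'M[C]_(m, n)) (B : 'M[C]_(n, p)) :
  adj (A *m B) = adj B *m adj A.
Proof. by rewrite /adj map_mxM trmx_mul. Qed.

Lemma adjD m n (A B : 'M[C]_(m, n)) : adj (A + B) = adj A + adj B.
Proof. by rewrite /adj map_mxD linearD. Qed.

Lemma adjN m n (A : 'M[C]_(m, n)) : adj (- A) = - adj A.
Proof. by rewrite /adj map_mxN linearN. Qed.

Lemma adjB m n (A B : 'M[C]_(m, n)) : adj (A - B) = adj A - adj B.
Proof. by rewrite adjD adjN. Qed.

Lemma adj0 m n : adj (0 : 'M[C]_(m, n)) = 0.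
Proof. by rewrite /adj map_mx0 trmx0. Qed.

Lemma adj_sum m n I (r : seq I) (P : pred I) (F : I -> 'M[C]_(m, n)) :
  adj (\sum_(i <- r | P i) F i) = \sum_(i <- r | P i) adj (F i).
Proof. exact: (big_morph _ (@adjD m n) (adj0 m n)). Qed.

Lemma adjZ m n (a : C) (A : 'M[C]_(m, n)) : adj (a *: A) = Num.conj a *: adj A.
Proof. by apply/matrixP => i j; rewrite !mxE rmorphM. Qed.

Lemma adj_scalar n (a : C) : adj (a%:M : 'M[C]_n) = (Num.conj a)%:M.
Proof. by rewrite /adj map_scalar_mx tr_scalar_mx. Qed.

Lemma adj1 n : adj (1%:M : 'M[C]_n) = 1%:M.
Proof. by rewrite adj_scalar rmorph1. Qed.

Lemma adj_tens m n p q (A : 'M[C]_(m, n)) (B : 'M[C]_(p, q)) :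
  adj (A *t B) = adj A *t adj B.
Proof. by rewrite /adj map_mxT trmx_tens. Qed.

Lemma adj_row m n p (A : 'M[C]_(m, n)) (B : 'M[C]_(m, p)) :
  adj (row_mx A B) = col_mx (adj A) (adj B).
Proof. by rewrite /adj map_row_mx tr_row_mx. Qed.

Lemma adj_block m n p q (A : 'M[C]_(m, n)) (B : 'M[C]_(m, p))
    (A' : 'M[C]_(q, n)) (B' : 'M[C]_(q, p)) :
  adj (block_mx A B A' B') = block_mx (adj A) (adj A') (adj B) (adj B').
Proof. by rewrite /adj map_block_mx tr_block_mx. Qed.

Lemma gram_ge0 m (v : 'cV[C]_m) : 0 <= (adj v *m v) 0 0.
Proof.
rewrite mxE sumr_ge0 // => i _; rewrite adjE mulrC; exact: mul_conjC_ge0.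
Qed.

Lemma gram_eq0 m n (V : 'M[C]_(m, n)) : adj V *m V = 0 -> V = 0.
Proof.
move=> /matrixP V0; apply/matrixP => i j; move: (V0 j j); rewrite !mxE.
under eq_bigr do rewrite adjE mulrC.
move=> /psumr_eq0P V0'; apply/eqP; rewrite -mul_conjC_eq0; apply/eqP.
by apply: V0' => // k _; exact: mul_conjC_ge0.
Qed.

Lemma mx11_eq0 (A : 'M[C]_1) : A 0 0 = 0 -> A = 0.
Proof. by move=> A0; apply/matrixP => i j; rewrite !ord1 A0 mxE. Qed.

Lemma psdD n (A B : 'M[C]_n) : psd A -> psd B -> psd (A + B).
Proof.
case=> hA pA [hB pB]; split; first by rewrite /Defs.hermitian adjD hA hB.
by move=> v; rewrite mulmxDr mulmxDl mxE addr_ge0.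
Qed.

Lemma psd_conj m n (V : 'M[C]_(m, n)) (A : 'M[C]_m) :
  psd A -> psd (adj V *m A *m V).
Proof.
case=> hA pA; split; first by rewrite /Defs.hermitian !adjM adjK hA mulmxA.
by move=> v; have := pA (V *m v); rewrite adjM !mulmxA.
Qed.

Lemma psd1 n : psd (1%:M : 'M[C]_n).
Proof. by split; [exact: adj1 | move=> v; rewrite mulmx1 gram_ge0]. Qed.

Lemma psd_gram m n (V : 'M[C]_(m, n)) : psd (adj V *m V).
Proof. by have := psd_conj V (psd1 m); rewrite mulmx1. Qed.

Lemma psd0 n : psd (0 : 'M[C]_n).
Proof. by have := psd_gram (0 : 'M[C]_n); rewrite mulmx0. Qed.

Lemma psd_sum n I (r : seq I) (P : pred I) (F : I -> 'M[C]_n) :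
  (forall i, P i -> psd (F i)) -> psd (\sum_(i <- r | P i) F i).
Proof. by move=> pF; apply: big_ind => //; [exact: psd0 | exact: psdD]. Qed.

Lemma psdZ n (a : C) (A : 'M[C]_n) : 0 <= a -> psd A -> psd (a *: A).
Proof.
move=> a0 [hA pA]; split; last first.
  by move=> v; rewrite -scalemxAr -scalemxAl mxE mulr_ge0.
by rewrite /Defs.hermitian adjZ hA; congr (_ *: _); exact/CrealP/ger0_real.
Qed.

(** Moving from v a little in the direction -A v would make the form negative unless A v = 0. *)
Lemma psd_ker n (A : 'M[C]_n) (v : 'cV[C]_n) :
  psd A -> (adj v *m A *m v) 0 0 = 0 -> A *m v = 0.
Proof.
move=> [hA pA] v0; apply: gram_eq0; apply: mx11_eq0.
set u := A *m v; have uE : adj u = adj v *m A by rewrite adjM hA.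
set s := (adj u *m u) 0 0; set m := (adj u *m A *m u) 0 0.
have s0 : 0 <= s by exact: gram_ge0.
have m0 : 0 <= m by exact: pA.
have m1 : 0 < m + 1 by rewrite ltr_wpDl.
(* The form at v - e u is e^2 m - 2 e s. This step length makes it negative for s > 0; the
   denominator is m + 1 because m may vanish. *)
pose e := s / (m + 1).
have e0 : 0 <= e by rewrite divr_ge0 // ltW.
have ec : Num.conj e = e by exact/CrealP/ger0_real.
have := pA (v - e *: u).
have -> : (adj (v - e *: u) *m A *m (v - e *: u)) 0 0 = e ^+ 2 * m - 2 * e * s.
  have vAu : adj v *m A *m u = adj u *m u by rewrite uE.
  have uAv : adj u *m A *m v = adj u *m u by rewrite -mulmxA.
  rewrite adjB adjZ ec !mulmxBl !mulmxBr -!scalemxAl -!scalemxAr vAu uAv.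
  have -> : adj v *m A *m v = 0 by exact: mx11_eq0.
  have entB (M N : 'M[C]_1) : (M - N) 0 0 = M 0 0 - N 0 0 by rewrite !mxE.
  have entZ a (M : 'M[C]_1) : (a *: M) 0 0 = a * M 0 0 by rewrite !mxE.
  rewrite !(entB, entZ) [(0 : 'M_1) 0 0]mxE -/s -/m.
  ring.
have -> : e ^+ 2 * m - 2 * e * s = - (s ^+ 2 * (m + 2) / (m + 1) ^+ 2).
  by rewrite /e; field; rewrite gt_eqF.
rewrite oppr_ge0 -mulrA pmulr_lle0 => [s2|]; last first.
  by rewrite divr_gt0 ?exprn_gt0 // ltr_wpDl.
by apply/eqP; rewrite -sqrf_eq0 eq_le s2 exprn_ge0.
Qed.

Lemma isometry_le p q (U : 'M[C]_(q, p)) : adj U *m U = 1%:M -> (p <= q)%N.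
Proof. exact: mulmx1_min. Qed.

Lemma unitary_sq p q (U : 'M[C]_(p, q)) :
  p = q -> adj U *m U = 1%:M -> U *m adj U = 1%:M.
Proof. by move=> e; case: q / e U => U /mulmx1C. Qed.

(** An orthonormal basis S of the left kernel of W, obtained by Gram-Schmidt, supplies the missing
    columns as S^*. The result is square because the kernel has dimension q - n. *)
Lemma isometry_completion n q (W : 'M[C]_(q, n)) : adj W *m W = 1%:M ->
  exists m (W' : 'M[C]_(q, m)),
    adj (row_mx W W') *m row_mx W W' = 1%:M /\
    row_mx W W' *m adj (row_mx W W') = 1%:M.
Proof.
move=> WW; pose K := kermx W; pose S := schmidt (row_base K).
have uS : S \is unitarymx.
  by apply: schmidt_unitarymx; rewrite rank_leq_col.
have SS : S *m adj S = 1%:M.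
  rewrite -(unitarymxP uS); congr (_ *m _).
  by apply/matrixP => i j; rewrite !mxE.
have SW : S *m W = 0.
  apply/sub_kermxP.
  by rewrite eqmx_schmidt_free ?eq_row_base ?row_base_free.
have uu : adj (row_mx W (adj S)) *m row_mx W (adj S) = 1%:M.
  rewrite adj_row adjK mul_col_row WW SW SS.
  have -> : adj W *m adj S = 0 by rewrite -adjM SW adj0.
  by rewrite -scalar_mx_block.
exists (\rank K), (adj S); split=> //; apply: unitary_sq => //.
rewrite mxrank_ker.
have -> : \rank W = n.
  apply/eqP; rewrite eqn_leq rank_leq_col /=.
  by apply: (@mulmx1_min_rank _ _ _ _ _ (adj W) 1%:M); rewrite mulmx1.
by rewrite subnKC // (isometry_le WW).
Qed.

End Adjoint.

(** * Additivity of the Kronecker product in its right factor *)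

Section Tensor.
Variable K : comNzRingType.

Lemma tensmxDr m n p q (A : 'M[K]_(m, n)) (B B' : 'M[K]_(p, q)) :
  A *t (B + B') = A *t B + A *t B'.
Proof. by apply/matrixP => i j; rewrite !mxE mulrDr. Qed.

Lemma tensmxNr m n p q (A : 'M[K]_(m, n)) (B : 'M[K]_(p, q)) :
  A *t (- B) = - (A *t B).
Proof. by apply/matrixP => i j; rewrite !mxE mulrN. Qed.

Lemma tensmx_sumr m n p q I (r : seq I) (P : pred I) (A : 'M[K]_(m, n))
    (F : I -> 'M[K]_(p, q)) :
  A *t (\sum_(i <- r | P i) F i) = \sum_(i <- r | P i) A *t F i.
Proof. exact: (big_morph _ (@tensmxDr m n p q A) (tensmx0 A)). Qed.

Lemma tensmx11 m n : (1%:M : 'M[K]_m) *t (1%:M : 'M[K]_n) = 1%:M.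
Proof.
apply/matrixP => i j; case: (mxtens_indexP i) => i0 i1.
case: (mxtens_indexP j) => j0 j1.
by rewrite tensmxE !mxE -natrM mulnb (can_eq (@mxtens_indexK m n)) xpair_eqE.
Qed.

End Tensor.

(** * A linear-algebraic criterion for free extreme points of a spectrahedron *)

Section FreeExtreme.
Variables (R : realType) (g d : nat).
Local Notation C := R[i].
Variable A : 'I_g -> 'M[C]_d.

Definition pencil n (X : 'I_g -> 'M[C]_n) : 'M[C]_(d * n) :=
  1%:M - \sum_(j < g) A j *t X j.

Lemma pencil_congr m n (V : 'M[C]_(m, n)) (Y : 'I_g -> 'M[C]_m) :
  adj (1%:M *t V) *m pencil Y *m (1%:M *t V) =
  1%:M *t (adj V *m V) - \sum_j A j *t (adj V *m Y j *m V).
Proof.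
rewrite adj_tens adj1 mulmxBr mulmxBl mulmx1 tensmx_mul mulmx1.
rewrite mulmx_sumr mulmx_suml; congr (_ - _).
by apply: eq_bigr => j _; rewrite !tensmx_mul mul1mx mulmx1.
Qed.

Lemma pencil_mconv n k (e : 'I_k -> nat) (V : forall i, 'M[C]_(e i, n))
    (Y : forall i, 'I_g -> 'M[C]_(e i)) : isometric_family V ->
  pencil (mconv_comb V Y) =
  \sum_i adj (1%:M *t V i) *m pencil (Y i) *m (1%:M *t V i).
Proof.
move=> isoV; under [RHS]eq_bigr do rewrite pencil_congr.
rewrite sumrB -tensmx_sumr isoV tensmx11 exchange_big /=; congr (_ - _).
by apply: eq_bigr => j _; rewrite -tensmx_sumr.
Qed.

Lemma spectrahedron_compress m n (V : 'M[C]_(m, n)) (Y : 'I_g -> 'M[C]_m) :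
  adj V *m V = 1%:M -> spectrahedron A Y ->
  spectrahedron A (fun j => adj V *m Y j *m V).
Proof.
move=> VV [hY pY]; split.
  by move=> j; rewrite /Defs.hermitian !adjM adjK hY mulmxA.
have := psd_conj (1%:M *t V) pY.
by rewrite -/(pencil Y) pencil_congr VV tensmx11.
Qed.

(** The columns of N are kernel vectors of the pencil at X. The dilation system is stated for rows
    b_j, so that its size does not depend on the sizes of the Y_i: it is applied to each row of Y_ij
    V_i - V_i X_j. *)
Lemma free_extreme_criterion n r (X : 'I_g -> 'M[C]_n)
    (N : 'M[C]_(d * n, r)) :
  spectrahedron A X ->
  pencil X *m N = 0 ->
  (forall b : 'I_g -> 'rV[C]_n,
     (\sum_j (A j *t b j)) *m N = 0 -> forall j, b j = 0) ->
  (forall P : 'M[C]_n, (forall j, P *m X j = X j *m P) -> exists c, P = c%:M) ->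
  free_extreme (spectrahedron A) X.
Proof.
move=> DX XN dilN commX; split=> // k e V Y V0 DY isoV Xeq i.
have hX : forall j, adj (X j) = X j by case: DX.
have hY : forall i j, adj (Y i j) = Y i j by move=> l; case: (DY l).
have YN : pencil (Y i) *m ((1%:M *t V i) *m N) = 0.
  apply/matrixP => a c; set M := _ *m _.
  suff /colP/(_ a) : col c M = 0 by rewrite !mxE.
  rewrite colE /M -!mulmxA; apply: psd_ker; first by case: (DY i).
  set v := N *m _; rewrite adjM.
  have q0 : (adj v *m pencil X *m v) 0 0 = 0.
    by rewrite -mulmxA (mulmxA (pencil X)) XN mul0mx mulmx0 mxE.
  (* By [pencil_mconv] this zero is a sum of nonnegative terms, one for each Y_l, so the i-th term
     vanishes. *)
  have := q0; rewrite Xeq pencil_mconv // mulmx_sumr mulmx_suml summxE.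
  move/psumr_eq0P => /(_ _ i isT) <-; first by rewrite !mulmxA.
  by move=> l _; case: (psd_conj (1%:M *t V l) (proj2 (DY l))).
have VX j : Y i j *m V i = V i *m X j.
  apply/eqP; rewrite -subr_eq0; apply/eqP/row_matrixP => p; rewrite row0.
  pose b j := row p (Y i j *m V i - V i *m X j).
  rewrite -[LHS]/(b j); apply: dilN.
  have -> : \sum_j (A j *t b j) =
      (1%:M *t delta_mx 0 p) *m \sum_j A j *t (Y i j *m V i - V i *m X j).
    rewrite mulmx_sumr; apply: eq_bigr => l _.
    by rewrite tensmx_mul mul1mx /b rowE.
  rewrite -mulmxA; suff -> : (\sum_j A j *t (Y i j *m V i - V i *m X j)) *m N = 0.
    by rewrite mulmx0.
  under eq_bigr do rewrite tensmxDr tensmxNr.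
  rewrite sumrB mulmxBl.
  have -> : \sum_j A j *t (V i *m X j) = (1%:M *t V i) *m \sum_j A j *t X j.
    by rewrite mulmx_sumr; apply: eq_bigr => l _; rewrite tensmx_mul mul1mx.
  have -> : \sum_j A j *t (Y i j *m V i) = (\sum_j A j *t Y i j) *m (1%:M *t V i).
    by rewrite mulmx_suml; apply: eq_bigr => l _; rewrite tensmx_mul mulmx1.
  move: YN XN; rewrite /pencil !mulmxBl !mul1mx => /eqP; rewrite subr_eq0.
  move=> /eqP YN /eqP; rewrite subr_eq0 => /eqP XN.
  by rewrite -!mulmxA -XN -YN subrr.
(* Since both tuples are self-adjoint, V_i^* intertwines in the opposite direction, hence V_i^* V_i
   commutes with every X_j. *)
have [c Vc] : exists c, adj (V i) *m V i = c%:M.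
  apply: commX => j; rewrite -mulmxA -VX !mulmxA; congr (_ *m _).
  by rewrite -{1}(hY i) -adjM VX adjM hX.
(* This provides a basis vector e_z, in particular n > 0; then c = |V_i e_z|^2 is nonnegative. *)
have [z Vz] : exists z, V i *m delta_mx z (0 : 'I_1) != 0.
  apply/existsP; apply: contraNT (V0 i); rewrite negb_exists => /forallP Vz.
  apply/eqP/matrixP => a z; have /eqP/colP/(_ a) := negbNE (Vz z).
  by rewrite -colE !mxE.
have c0 : 0 < c.
  rewrite lt_neqAle; apply/andP; split.
    apply/eqP => ce; case/eqP: (V0 i); apply: gram_eq0.
    by rewrite Vc -ce raddf0.
  have := gram_ge0 (V i *m delta_mx z 0).
  rewrite adjM mulmxA -(mulmxA _ _ (V i)) Vc mul_mx_scalar -scalemxAl !mxE.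
  rewrite (bigD1 z) //= big1 => [|l /negbTE lz].
    by rewrite adjE !mxE !eqxx rmorph1 mulr1 addr0 mulr1.
  by rewrite adjE !mxE lz !andFb rmorph0 mul0r.
pose s := sqrtC c.
have s0 : 0 < s by rewrite sqrtC_gt0.
have sR : Num.conj s^-1 = s^-1 by apply/CrealP; rewrite realV gtr0_real.
pose W := s^-1 *: V i.
have WW : adj W *m W = 1%:M.
  rewrite /W adjZ -scalemxAl -scalemxAr Vc sR !scalerA -invfM -expr2 sqrtCK.
  by rewrite scale_scalar_mx mulVf // gt_eqF.
have WX j : Y i j *m W = W *m X j by rewrite -scalemxAl -scalemxAr VX.
have [m [W' [U1 U2]]] := isometry_completion WW.
have := U1; rewrite adj_row mul_col_row scalar_mx_block.
move/eq_block_mx => [_ WW' W'W W'W'].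
(* A square W is covered as well, with Z of size m = 0. *)
right; exists m, (fun j => adj W' *m Y i j *m W'); split.
  exact: spectrahedron_compress.
exists (row_mx W W'); split=> //; split=> // j.
rewrite adj_row mul_col_mx mul_col_row /dsum.
have -> : adj W *m Y i j *m W = X j by rewrite -mulmxA WX mulmxA WW mul1mx.
have -> : adj W' *m Y i j *m W = 0 by rewrite -mulmxA WX mulmxA W'W mul0mx.
have -> // : adj W *m Y i j *m W' = 0.
by rewrite -[adj W *m _]adjK adjM adjK hY WX adjM -mulmxA WW' mulmx0.
Qed.

End FreeExtreme.

(** * Positivity and kernel of 1 - H from a quartic identity *)

Section PsdFromSquare.
Variables (R : realType) (n : nat).
Local Notation C := R[i].

(* 1 - H = (1 - H)^2 / 2 + (1 - H^2) / 2 *)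
Lemma psd_of_square (H : 'M[C]_n) :
  Defs.hermitian H -> psd (1%:M - H *m H) -> psd (1%:M - H).
Proof.
move=> hH pQ.
have hB : adj (1%:M - H) = 1%:M - H by rewrite adjB adj1 hH.
have -> : 1%:M - H =
    2^-1 *: (adj (1%:M - H) *m (1%:M - H)) + 2^-1 *: (1%:M - H *m H).
  rewrite hB -scalerDr mulmxBr mulmx1 mulmxBl mul1mx opprB addrA.
  have -> : 1%:M - H + (H *m H - H) + 1%:M - H *m H = 2 *: (1%:M - H).
    move: (H *m H) => M; apply/matrixP => i j; rewrite !mxE; ring.
  by rewrite scalerA mulVf ?scale1r // pnatr_eq0.
apply: psdD; apply: psdZ; rewrite ?invr_ge0 ?ler0n //; exact: psd_gram.
Qed.

Variables (H : 'M[C]_n) (t : C).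
Let Q := 1%:M - H *m H.
Hypothesis quartic : Q *m Q = t *: Q.

(** Here (1 - H)(1 + H) = Q and Q (t - Q) = 0. The right factor serves as the matrix N of
    [free_extreme_criterion]. *)
Lemma quartic_kernel : (1%:M - H) *m ((1%:M + H) *m (t%:M - Q)) = 0.
Proof.
have -> : (1%:M - H) *m ((1%:M + H) *m (t%:M - Q)) = Q *m (t%:M - Q).
  rewrite mulmxA; congr (_ *m _).
  by rewrite mulmxDr mulmx1 mulmxBl mul1mx /Q addrA subrK.
by rewrite mulmxBr quartic mul_mx_scalar subrr.
Qed.

(** The identity turns Q into the Gram matrix t^-1 Q^* Q. *)
Lemma psd_of_quartic : Defs.hermitian H -> 0 < t -> psd (1%:M - H).
Proof.
move=> hH t0; apply: psd_of_square => //; rewrite -/Q.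
have hQ : adj Q = Q by rewrite adjB adj1 adjM hH.
have -> : Q = t^-1 *: (adj Q *m Q).
  by rewrite hQ quartic scalerA mulVf ?scale1r // gt_eqF.
by apply: psdZ; [rewrite invr_ge0 ltW | exact: psd_gram].
Qed.

End PsdFromSquare.

(** * Exact arithmetic in towers of quadratic extensions of the rationals *)

(** Bare operations without laws, so that certificates run inside [vm_compute]. The test [nis0] is
    trusted only when it answers [true]. *)
Record numops := NumOps {
  car :> Type; n0 : car; n1 : car;
  nadd : car -> car -> car; nmul : car -> car -> car;
  nopp : car -> car; ninv : car -> car; nis0 : car -> bool }.

(* No axiom on [ninv]: the elimination below checks the inverses that it uses. *)
Record numspec (F : pzRingType) (o : numops) (ev : o -> F) : Prop := NumSpec {
  ev0 : ev (n0 o) = 0;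
  ev1 : ev (n1 o) = 1;
  evD : forall a b, ev (nadd a b) = ev a + ev b;
  evM : forall a b, ev (nmul a b) = ev a * ev b;
  evN : forall a, ev (nopp a) = - ev a;
  evZ : forall a, nis0 a -> ev a = 0 }.

(** [Qplus'] and [Qmult'] reduce fractions, which keeps numerators small during elimination; a zero
    left factor short-circuits the product. *)
Definition Qops := NumOps (0#1) (1#1) Qplus'
  (fun a b => if Z.eqb (Qnum a) 0 then 0#1 else Qmult' a b)
  Qopp Qinv (fun a => Z.eqb (Qnum a) 0).

(* Represents [K(r)] with [r ^ 2 = d]; the pair [(a, b)] stands for [a + b r]. *)
Definition quad_ops (o : numops) (d : o) : numops :=
  @NumOps (o * o)%type (n0 o, n0 o) (n1 o, n0 o)
    (fun a b => (nadd a.1 b.1, nadd a.2 b.2))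
    (fun a b => (nadd (nmul a.1 b.1) (nmul d (nmul a.2 b.2)),
                 nadd (nmul a.1 b.2) (nmul a.2 b.1)))
    (fun a => (nopp a.1, nopp a.2))
    (fun a => let e := ninv (nadd (nmul a.1 a.1) (nopp (nmul d (nmul a.2 a.2)))) in
              (nmul a.1 e, nopp (nmul a.2 e)))
    (fun a => nis0 a.1 && nis0 a.2).

Section Evaluation.
Variable F : numFieldType.

Definition zev (z : Z) : F := (int_of_Z z)%:~R.
Definition evQ (q : Q) : F := zev (Qnum q) / zev (Zpos (Qden q)).

Lemma zevM a b : zev (Z.mul a b) = zev a * zev b.
Proof.
rewrite /zev -intrM; congr (_ %:~R).
exact: (rmorphM (int_of_Z : {rmorphism Z -> int}) a b).
Qed.

Lemma zevD a b : zev (Z.add a b) = zev a + zev b.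
Proof.
rewrite /zev -intrD; congr (_ %:~R).
exact: (rmorphD (int_of_Z : {rmorphism Z -> int}) a b).
Qed.

Lemma zevN a : zev (Z.opp a) = - zev a.
Proof.
rewrite /zev -mulrNz; congr (_ %:~R).
exact: (rmorphN (int_of_Z : {rmorphism Z -> int}) a).
Qed.

Lemma zev_pos p : zev (Zpos p) != 0.
Proof.
rewrite /zev intr_eq0 /=; case: (Pos2Nat.is_succ p) => k -> //.
Qed.

Lemma evQ_eq p q : Qeq p q -> evQ p = evQ q.
Proof.
rewrite /Qeq /evQ => /(congr1 zev); rewrite !zevM => e.
by apply/eqP; rewrite eqr_div ?zev_pos // e.
Qed.

Lemma evQ_spec : @numspec F Qops evQ.
Proof.
have z0 a : Z.eqb (Qnum a) 0 -> evQ a = 0.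
  by move=> /Z.eqb_eq a0; rewrite /evQ a0 mul0r.
split=> [||a b|a b|a|a]; first exact: z0; last exact: z0.
- by rewrite /evQ divff // zev_pos.
- rewrite -[nadd a b]/(Qplus' a b) (evQ_eq (Qplus'_correct a b)) /evQ /=.
  by rewrite zevD !zevM addf_div ?zev_pos // Pos2Z.inj_mul zevM.
- rewrite -[nmul a b]/(if Z.eqb (Qnum a) 0 then 0#1 else Qmult' a b).
  case: ifP => [/z0 ->|_]; first by rewrite mul0r z0.
  rewrite (evQ_eq (Qmult'_correct a b)) /evQ /= zevM.
  by rewrite mulf_div Pos2Z.inj_mul zevM.
- by rewrite -[nopp a]/(Qopp a) /evQ /= zevN mulNr.
Qed.

Definition quad_ev (o : numops) (d : o) (ev : o -> F) (r : F) :
  quad_ops d -> F := fun a => ev a.1 + ev a.2 * r.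

Lemma quad_spec (o : numops) (d : o) (ev : o -> F) (r : F) :
  numspec ev -> r ^+ 2 = ev d -> numspec (@quad_ev o d ev r).
Proof.
case=> e0 e1 eD eM eN eZ rd; split; rewrite /quad_ev /=.
- by rewrite e0 mul0r addr0.
- by rewrite e0 e1 mul0r addr0.
- by move=> a b; rewrite !eD; ring.
- by move=> a b; rewrite !(eD, eM) -rd; ring.
- by move=> a; rewrite !eN; ring.
- by move=> a /andP[/eZ -> /eZ ->]; rewrite mul0r addr0.
Qed.

End Evaluation.

(** * Gaussian elimination as a certificate that a linear system has only the zero solution *)

Section Elimination.
Variable o : numops.

(** The row u - c v, where the shorter row is read as padded with zeros. *)
Fixpoint subscale (c : o) (u v : seq o) : seq o :=
  match u, v with
  | a :: u', b :: v' => nadd a (nopp (nmul c b)) :: subscale c u' v'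
  | [::], _ => [seq nopp (nmul c b) | b <- v]
  | _, [::] => u
  end.

Definition nhd (u : seq o) : o := head (n0 o) u.

Fixpoint pick_pivot (rows : seq (seq o)) : option (seq o) :=
  match rows with
  | [::] => None
  | u :: rows' => if nis0 (nhd u) then pick_pivot rows' else Some u
  end.

(** One column is eliminated per step. The inverse of the pivot is verified by a multiplication, and
    a row whose head is not recognised as cancelled is discarded: losing equations can only turn the
    answer into [false]. *)
Fixpoint full_rank (m : nat) (rows : seq (seq o)) : bool :=
  match m with
  | 0%N => true
  | m'.+1 =>
    match pick_pivot rows with
    | None => false
    | Some p =>
      let e := ninv (nhd p) in
      nis0 (nadd (nmul (nhd p) e) (nopp (n1 o))) &&
      full_rank m' (pmap (fun u =>
        if nis0 (nhd u) then Some (behead u) else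
        let w := subscale (nmul (nhd u) e) u p in
        if nis0 (nhd w) then Some (behead w) else None) rows)
    end
  end.

Variables (F : fieldType) (ev : o -> F).
Hypothesis evP : numspec ev.

Fixpoint dot (u : seq o) (x : seq F) : F :=
  match u, x with
  | a :: u', y :: x' => ev a * y + dot u' x'
  | _, _ => 0
  end.

Lemma dot_subscale c u v x :
  dot (subscale c u v) x = dot u x - ev c * dot v x.
Proof.
elim: x u v => [|y x IH] [|a u] [|b v] //=; rewrite ?mulr0 ?subr0 //.
- rewrite evN // evM // sub0r mulrDr opprD mulNr mulrA; congr (_ + _).
  elim: v x {IH} => [|a v IH] [|z x] /=; rewrite ?mulr0 ?oppr0 //.
  by rewrite IH evN // evM // mulrDr opprD mulNr mulrA.
- by rewrite IH evD // evN // evM //; ring.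
Qed.

Lemma dot_behead u y x : nis0 (nhd u) -> dot u (y :: x) = dot (behead u) x.
Proof.
case: u => [|a u] /=; first by case: x.
by move=> /(evZ evP) ->; rewrite mul0r add0r.
Qed.

(** The tail of x solves the reduced system and vanishes by induction; the pivot row then reads
    pivot * y = 0 with an invertible pivot. *)
Lemma full_rankP m rows x : size x = m -> full_rank m rows ->
  (forall u, List.In u rows -> dot u x = 0) -> x = nseq m 0.
Proof.
elim: m rows x => [|m IH] rows [|y x] //= [sx].
case Ep: (pick_pivot rows) => [p|] //= /andP[p1 fr] rows0.
have p0 : dot p (y :: x) = 0.
  apply: rows0; elim: rows Ep {fr} => //= u rows IHr.
  by case: ifP => _; [right; apply: IHr | case=> ->; left].
have x0 : x = nseq m 0.
  apply: (IH _ _ sx fr) => u.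
  elim: rows rows0 {Ep fr} => //= w rows IHr rows0.
  have IHr' := IHr (fun v vr => rows0 v (or_intror vr)).
  have w0 := rows0 w (or_introl erefl).
  case: ifP => [h0|_] /=.
    by case=> [<-|/IHr'] //; rewrite -(dot_behead y).
  case: ifP => [h0|_] //=; case=> [<-|/IHr'] //.
  by rewrite -(dot_behead y) // dot_subscale w0 p0 mulr0 subr0.
move: p1 => /(evZ evP); rewrite evD // evN // evM // ev1 //.
move/eqP; rewrite subr_eq0 => /eqP pe.
have hp : ev (nhd p) * y = 0.
  move: p0; case: (p) => [|a q] /=; first by rewrite ev0 // mul0r.
  suff -> : dot q x = 0 by rewrite addr0.
  by rewrite x0; elim: (m) (q) => [|k IHk] [|c q'] //=; rewrite mulr0 add0r.
congr (_ :: _) => //.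
move/eqP: hp; rewrite mulf_eq0 => /orP[/eqP hp|/eqP //].
by move: pe; rewrite hp mul0r => /eqP; rewrite eq_sym oner_eq0.
Qed.

Lemma dot_map (T : Type) (s : seq T) f g :
  dot [seq f k | k <- s] [seq g k | k <- s] = \sum_(k <- s) ev (f k) * g k.
Proof. by elim: s => [|k s IH] /=; rewrite ?big_nil // big_cons IH. Qed.

Definition form_row (a b : nat) (f : nat -> nat -> o) : seq o :=
  [seq f k.1 k.2 | k <- [seq (u, v) | u <- iota 0 a, v <- iota 0 b]].

(** Passes from unknowns with two indices to the flat vector of length a * b, in the order used by
    [form_row]. *)
Lemma full_rank_matrix a b (T : eqType) (ts : seq T)
    (f : T -> nat -> nat -> o) (x : 'I_a -> 'I_b -> F) :
  full_rank (a * b) [seq form_row a b (f t) | t <- ts] ->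
  (forall t, t \in ts ->
     \sum_(u < a) \sum_(v < b) ev (f t u v) * x u v = 0) ->
  forall u v, x u v = 0.
Proof.
move=> fr fs0.
(* The unknown is extended by 0 to all pairs of natural numbers, so that it can be mapped over the
   list of indices. *)
pose X (k : nat * nat) : F :=
  match insub k.1, insub k.2 with Some u, Some v => x u v | _, _ => 0 end.
pose s := [seq (u, v) | u <- iota 0 a, v <- iota 0 b].
have XE (u : 'I_a) (v : 'I_b) : X (nat_of_ord u, nat_of_ord v) = x u v.
  by rewrite /X /= !valK.
have x0 : [seq X k | k <- s] = nseq (a * b) 0.
  apply: full_rankP fr _ => [|w]; first by rewrite size_map size_allpairs !size_iota.
  case/List.in_map_iff => t [<- tts].
  have {}/fs0 f0 : t \in ts.
    elim: (ts) tts => //= z r IHr [->|/IHr zr]; first exact: mem_head.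
    by rewrite inE zr orbT.
  rewrite /form_row dot_map big_allpairs -[RHS]f0 /=.
  have i0 c : iota 0 c = index_iota 0 c by rewrite /index_iota subn0.
  rewrite i0 big_mkord; apply: eq_bigr => u _.
  rewrite i0 big_mkord; apply: eq_bigr => v _.
  by rewrite XE.
move=> u v; rewrite -XE.
have : (nat_of_ord u, nat_of_ord v) \in s.
  by apply/allpairsP; exists (nat_of_ord u, nat_of_ord v); rewrite !mem_iota !ltn_ord.
by move/(map_f X); rewrite x0 mem_nseq => /andP[_ /eqP].
Qed.

End Elimination.

(** * Certificates computed on representations of the matrix entries *)

Section Representation.
Variable o : numops.
Local Notation fmx := (nat -> nat -> o).

Definition fsum n (f : nat -> o) : o :=
  foldr (fun k s => nadd (f k) s) (n0 o) (iota 0 n).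

(** Terms whose left factor is recognised as zero are skipped, since the matrices are sparse. *)
Definition fdot n (f g : nat -> o) : o :=
  foldr (fun k s => let a := f k in if nis0 a then s else nadd (nmul a (g k)) s)
    (n0 o) (iota 0 n).

Definition fmul n (f g : fmx) : fmx := fun i j => fdot n (f i) (fun k => g k j).

Definition fscalar (c : o) : fmx := fun i j => if eqn i j then c else n0 o.

Definition fadd (f g : fmx) : fmx := fun i j => nadd (f i j) (g i j).

Definition fsub (f g : fmx) : fmx := fun i j => nadd (f i j) (nopp (g i j)).

(** Quotient and remainder follow the index convention of [*t], where the left factor varies
    slowest. *)
Definition ftens p q (f g : fmx) : fmx :=
  fun i j => nmul (f (i %/ p)%N (j %/ q)%N) (g (i %% p)%N (j %% q)%N).

(* Extensionally [f] on the index range, but evaluated only once. *)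
Definition tab m n (f : fmx) : fmx :=
  let t := [seq [seq f i j | j <- iota 0 n] | i <- iota 0 m] in
  fun i j => nth (n0 o) (nth [::] t i) j.

Definition feq0 m n (f : fmx) : bool :=
  all (fun i => all (fun j => nis0 (f i j)) (iota 0 n)) (iota 0 m).

Definition fblock m n (f g f' g' : fmx) : fmx := fun i j =>
  if (i < m)%N then if (j < n)%N then f i j else g i (j - n)%N
  else if (j < n)%N then f' (i - m)%N j else g' (i - m)%N (j - n)%N.

Variables (F : fieldType) (ev : o -> F).
Hypothesis evP : numspec ev.

Definition repr m n (A : 'M[F]_(m, n)) (f : fmx) :=
  forall i j, A i j = ev (f i j).

Lemma ev_fsum n f : ev (fsum n f) = \sum_(k < n) ev (f k).
Proof.
rewrite -(big_mkord xpredT (fun k => ev (f k))) /index_iota subn0 /fsum.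
elim: (iota 0 n) => [|k s IH]; first by rewrite big_nil (ev0 evP).
by rewrite big_cons /= (evD evP) IH.
Qed.

Lemma ev_fdot n f g : ev (fdot n f g) = \sum_(k < n) ev (f k) * ev (g k).
Proof.
rewrite -(big_mkord xpredT (fun k => ev (f k) * ev (g k))) /index_iota subn0.
rewrite /fdot; elim: (iota 0 n) => [|k s IH]; first by rewrite big_nil (ev0 evP).
rewrite big_cons /=; case: ifP => [/(evZ evP) ->|_]; first by rewrite mul0r add0r.
by rewrite (evD evP) (evM evP) IH.
Qed.

Lemma repr_mul m n p (A : 'M_(m, n)) (B : 'M_(n, p)) f g :
  repr A f -> repr B g -> repr (A *m B) (fmul n f g).
Proof.
by move=> rA rB i j; rewrite mxE ev_fdot; apply: eq_bigr => k _; rewrite rA rB.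
Qed.

Lemma repr_scalar n a c : a = ev c -> repr (a%:M : 'M_n) (fscalar c).
Proof.
move=> -> i j; rewrite mxE /fscalar -[eqn i j]/(i == j).
by case: eqP => _ //; rewrite (ev0 evP).
Qed.

Lemma repr_add m n (A B : 'M_(m, n)) f g :
  repr A f -> repr B g -> repr (A + B) (fadd f g).
Proof. by move=> rA rB i j; rewrite mxE rA rB (evD evP). Qed.

Lemma repr_sub m n (A B : 'M_(m, n)) f g :
  repr A f -> repr B g -> repr (A - B) (fsub f g).
Proof. by move=> rA rB i j; rewrite !mxE rA rB (evD evP) (evN evP). Qed.

Lemma repr_tens m n p q (A : 'M_(m, n)) (B : 'M_(p, q)) f g :
  repr A f -> repr B g -> repr (A *t B) (ftens p q f g).
Proof. by move=> rA rB i j; rewrite mxE rA rB /ftens (evM evP). Qed.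

Lemma repr_tab m n (A : 'M_(m, n)) f : repr A f -> repr A (tab m n f).
Proof.
move=> rA i j; rewrite /tab (nth_map 0%N) ?size_iota //.
by rewrite (nth_map 0%N) ?size_iota // !nth_iota // rA.
Qed.

Lemma repr_sum m n g (A : 'I_g -> 'M_(m, n)) (f : nat -> fmx) :
  (forall j, repr (A j) (f j)) ->
  repr (\sum_j A j) (fun i k => fsum g (fun j => f j i k)).
Proof.
by move=> rA i k; rewrite summxE ev_fsum; apply: eq_bigr => j _; rewrite rA.
Qed.

Lemma repr_block m n p q (A : 'M_(m, n)) (B : 'M_(m, p)) (A' : 'M_(q, n))
    (B' : 'M_(q, p)) f g f' g' :
  repr A f -> repr B g -> repr A' f' -> repr B' g' ->
  repr (block_mx A B A' B') (fblock m n f g f' g').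
Proof.
move=> rA rB rA' rB' i j; rewrite /fblock.
case: (split_ordP i) => i0 ->; case: (split_ordP j) => j0 -> /=.
- by rewrite block_mxEul rA.
- by rewrite block_mxEur rB addKn.
- by rewrite block_mxEdl rA' addKn.
- by rewrite block_mxEdr rB' !addKn.
Qed.

Lemma feq0P m n (A : 'M_(m, n)) f : repr A f -> feq0 m n f -> A = 0.
Proof.
move=> rA /allP f0; apply/matrixP => i j; rewrite mxE rA; apply: (evZ evP).
have : val i \in iota 0 m by rewrite mem_iota ltn_ord.
by move/f0/allP; apply; rewrite mem_iota ltn_ord.
Qed.

(** This is Q = 1 - H^2, the matrix that enters the quartic identity Q^2 = t Q. *)
Definition fquartic n (h : fmx) : fmx :=
  tab n n (fsub (fscalar (n1 o)) (fmul n h h)).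

Lemma repr_quartic n (H : 'M_n) h :
  repr H h -> repr (1%:M - H *m H) (fquartic n h).
Proof.
move=> rH; apply/repr_tab/repr_sub; last exact: repr_mul.
by apply: repr_scalar; rewrite (ev1 evP).
Qed.

Definition quartic_check n (h : fmx) (t : o) : bool :=
  let q := fquartic n h in feq0 n n (fsub (fmul n q q) (fmul n (fscalar t) q)).

Lemma quartic_checkP n (H : 'M_n) h t : repr H h -> quartic_check n h t ->
  (1%:M - H *m H) *m (1%:M - H *m H) = ev t *: (1%:M - H *m H).
Proof.
move=> rH ck; have rQ := repr_quartic rH; apply/eqP; rewrite -subr_eq0; apply/eqP.
rewrite -mul_scalar_mx; apply: feq0P ck; apply: repr_sub; apply: repr_mul => //.
exact: repr_scalar.
Qed.

Definition fpencil g n (fA fX : nat -> fmx) : fmx :=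
  fun i k => fsum g (fun j => ftens n n (fA j) (fX j) i k).

Lemma repr_pencil g d n (A : 'I_g -> 'M_d) (X : 'I_g -> 'M_n)
    (fA fX : nat -> fmx) :
  (forall j, repr (A j) (fA j)) -> (forall j, repr (X j) (fX j)) ->
  repr (\sum_j A j *t X j) (fpencil g n fA fX).
Proof. by move=> rA rX; apply: repr_sum => j; apply: repr_tens. Qed.

(** The kernel matrix (1 + H)(t - Q) of [quartic_kernel]. *)
Definition fker n (h : fmx) (t : o) : fmx :=
  let q := fquartic n h in
  tab n n (fmul n (fadd (fscalar (n1 o)) h) (fsub (fscalar t) q)).

(** The equation indexed by (a, k) is the entry (a, k) of (sum_j A_j (x) b_j) N = 0. The g * n
    unknowns are the entries b_j(v), and the row b * n + v of N is the one indexed by the pair (b,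
    v). *)
Definition dilation_check g d n (fA : nat -> fmx) (h : fmx) (t : o) : bool :=
  let ker := fker (d * n) h t in
  full_rank (g * n)
    [seq form_row g n (fun j v =>
       fsum d (fun b => nmul (fA j c.1 b) (ker (b * n + v)%N c.2)))
    | c <- [seq (a, k) | a <- iota 0 d, k <- iota 0 (d * n)]].

Lemma sum_tens d n (G : 'I_(d * n) -> F) :
  \sum_l G l = \sum_b \sum_v G (mxtens_index (b, v)).
Proof.
rewrite pair_bigA /= (reindex (@mxtens_index d n)) /=.
  by apply: eq_bigr => -[].
by exists (@mxtens_unindex d n) => l _; rewrite ?mxtens_indexK ?mxtens_unindexK.
Qed.

Lemma dilation_checkP g d n (A : 'I_g -> 'M_d) (H : 'M_(d * n))
    (fA : nat -> fmx) h t (b : 'I_g -> 'rV_n) :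
  (forall j, repr (A j) (fA j)) -> repr H h -> dilation_check g d n fA h t ->
  (\sum_j A j *t b j) *m
    ((1%:M + H) *m ((ev t)%:M - (1%:M - H *m H))) = 0 ->
  forall j, b j = 0.
Proof.
move=> rA rH ck; set N := (1%:M + H) *m _ => bN j; apply/rowP => v; rewrite mxE.
have rN : repr N (fker (d * n) h t).
  apply/repr_tab/repr_mul.
    by apply: repr_add => //; apply: repr_scalar; rewrite (ev1 evP).
  by apply: repr_sub; [exact: repr_scalar | exact: repr_quartic].
apply: (full_rank_matrix evP (x := fun j v => b j 0 v) ck) => -[a k] /=.
case/allpairsP => -[a' k'] [/=]; rewrite !mem_iota /= !add0n => ad kd [-> ->].
have /matrixP/(_ (mxtens_index (Ordinal ad, 0)) (Ordinal kd)) := bN.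
rewrite [RHS]mxE => e; apply: etrans e; rewrite mxE sum_tens.
under [RHS]eq_bigr => c _ do under eq_bigr => u _ do
  rewrite summxE mulr_suml.
transitivity (\sum_(u < g) \sum_(w < n) \sum_(c < d)
   A u (Ordinal ad) c * b u 0 w * N (mxtens_index (c, w)) (Ordinal kd)).
  apply: eq_bigr => u _; apply: eq_bigr => w _; rewrite ev_fsum mulr_suml.
  by apply: eq_bigr => c _; rewrite (evM evP) rN rA mulrAC.
rewrite exchange_big [RHS]exchange_big /=; apply: eq_bigr => w _.
rewrite [RHS]exchange_big /=; apply: eq_bigr => u _.
by apply: eq_bigr => c _; rewrite tensmxE.
Qed.

(** [Some (j, s, t)] is the entry (s, t) of P X_j - X_j P = 0. Scalar matrices always solve these
    equations, so [None] adds P(0, 0) = 0 and the system can have full rank. *)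
Definition commutant_check g n (fX : nat -> fmx) : bool :=
  full_rank (n * n)
    [seq form_row n n (fun u v =>
       if c is Some (j, s, t) then
         nadd (if eqn u s then fX j v t else n0 o)
              (nopp (if eqn v t then fX j s u else n0 o))
       else if eqn u 0 && eqn v 0 then n1 o else n0 o)
    | c <- None :: [seq Some (c.1, c.2, t) |
        c <- [seq (j, s) | j <- iota 0 g, s <- iota 0 n], t <- iota 0 n]].

Lemma commutant_checkP g n (X : 'I_g -> 'M_n.+1) (fX : nat -> fmx)
    (P : 'M_n.+1) :
  (forall j, repr (X j) (fX j)) -> commutant_check g n.+1 fX ->
  (forall j, P *m X j = X j *m P) -> exists c, P = c%:M.
Proof.
move=> rX ck PX; exists (P 0 0).
(* Subtracting this scalar preserves commutation and makes the additional equation [None] hold. *)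
pose P' := P - (P 0 0)%:M.
have PX' j : P' *m X j = X j *m P' by rewrite mulmxBl mulmxBr PX scalar_mxC.
apply/eqP; rewrite -subr_eq0 -/P'; apply/eqP/matrixP => u v; rewrite [RHS]mxE.
have sel m (G : 'I_m -> F) (i : 'I_m) :
    \sum_(k < m) (if eqn k i then G k else 0) = G i.
  rewrite (bigD1 i) //= -[eqn i i]/(val i == val i) eqxx big1 ?addr0 // => k ki.
  by rewrite -[eqn k i]/(val k == val i) (inj_eq val_inj) (negbTE ki).
apply: (full_rank_matrix evP (x := fun u v => P' u v) ck) => -[[[j s] t]|]; last first.
  move=> _; change (\sum_(u < n.+1) \sum_(v < n.+1)
    ev (if eqn u 0 && eqn v 0 then n1 o else n0 o) * P' u v = 0).
  transitivity (\sum_(k < n.+1) (if eqn k 0 then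
     \sum_(l < n.+1) (if eqn l 0 then P' k l else 0) else 0)).
    apply: eq_bigr => k _; case: ifP => k0; last first.
      by rewrite big1 // => l _; rewrite (ev0 evP) mul0r.
    apply: eq_bigr => l _; rewrite andTb; case: ifP => _.
      by rewrite (ev1 evP) mul1r.
    by rewrite (ev0 evP) mul0r.
  have sel0 (G : 'I_n.+1 -> F) : \sum_(k < n.+1) (if eqn k 0 then G k else 0) = G 0.
    exact: (sel _ G 0).
  by rewrite !sel0 !mxE eqxx mulr1n subrr.
rewrite in_cons => /orP[//|/allpairsP[[c t'] [cP tn [-> -> ->]]]].
case/allpairsP: cP => -[j' s'] [jg sn cE].
move: cE tn jg sn => /= -> /= {c t j s}; rename j' into j, s' into s, t' into t.
rewrite -[0%N :: iota 1 n]/(iota 0 n.+1) !mem_iota /= !add0n => tn jg sn.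
pose J := Ordinal jg; pose S := Ordinal sn; pose T := Ordinal tn.
have /matrixP/(_ S T)/eqP := PX' J; rewrite -subr_eq0 => /eqP e; apply: etrans e; rewrite !mxE.
transitivity (\sum_(k < n.+1) (if eqn k S then \sum_(l < n.+1) X J l T * P' k l else 0)
  - \sum_(k < n.+1) \sum_(l < n.+1) (if eqn l T then X J S k * P' k l else 0)).
  rewrite -sumrB; apply: eq_bigr => k _.
  have -> : (if eqn k S then \sum_(l < n.+1) X J l T * P' k l else 0) =
      \sum_(l < n.+1) (if eqn k S then X J l T * P' k l else 0).
    by case: ifP => // _; rewrite big1.
  rewrite -sumrB; apply: eq_bigr => l _.
  rewrite (evD evP) (evN evP) mulrDl mulNr.
  by congr (_ - _); case: ifP; rewrite ?rX ?(ev0 evP) ?mul0r.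
rewrite sel; congr (_ - _); first by apply: eq_bigr => l _; rewrite mulrC.
by apply: eq_bigr => k _; rewrite sel.
Qed.

End Representation.

(** * The two exceptional tuples *)

Section Tables.
Variable o : numops.

Definition ftable (t : seq (seq o)) : nat -> nat -> o :=
  fun i j => nth (n0 o) (nth [::] t i) j.

Definition fconst0 : nat -> nat -> o := fun _ _ => n0 o.

Definition fF3 (j : nat) : nat -> nat -> o :=
  let z := ftable [:: [:: n1 o; n0 o]; [:: n0 o; nopp (n1 o)]] in
  let x := ftable [:: [:: n0 o; n1 o]; [:: n1 o; n0 o]] in
  if eqn j 0 then ftens 2 2 z z
  else if eqn j 1 then ftens 2 2 x z else ftens 2 2 (fscalar (n1 o)) x.

Definition fXof m (c cbar : nat -> nat -> nat -> o) (j : nat) :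
    nat -> nat -> o :=
  fblock m m fconst0 (c j) (cbar j) fconst0.

(** The three checks yield positivity together with the kernel, the intertwining relation, and the
    trivial commutant; H is tabulated once for the first two. *)
Definition certificate n (fX : nat -> nat -> nat -> o) (t : o) : bool :=
  let h := tab (4 * n) (4 * n) (fpencil 3 n fF3 fX) in
  [&& quartic_check (4 * n) h t, dilation_check 3 4 n fF3 h t
    & commutant_check 3 n fX].

End Tables.

(** Only the outermost root changes sign: this is complex conjugation when that root is i and the
    inner field is real. *)
Definition fconj (o : numops) (d : o) (f : nat -> nat -> quad_ops d) :
    nat -> nat -> quad_ops d :=
  fun i j => let x := f i j in (x.1, nopp x.2).

Definition Qs3 := quad_ops (o := Qops) (3#1).
Definition Qs3i := quad_ops (o := Qs3) ((-1)#1, 0#1).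

(** [r a b] is a + b sqrt 3 and [i a b] is (a + b sqrt 3) i; denominators are rationalised, as in
    1/sqrt 3 = (sqrt 3)/3. *)
Definition c4 (j : nat) : nat -> nat -> Qs3i :=
  let r a b : Qs3i := ((a, b), (0#1, 0#1)) in
  let i a b : Qs3i := ((0#1, 0#1), (a, b)) in
  ftable (if eqn j 0 then [:: [:: r (1#2) (1#6); r (0#1) (0#1)];
                              [:: r (0#1) (0#1); r ((-1)#2) (1#2)]]
  else if eqn j 1 then [:: [:: r (0#1) (0#1); r (1#2) (0#1)];
                           [:: r (1#2) (0#1); r (0#1) (0#1)]]
  else [:: [:: i ((-1)#2) (1#3); r (0#1) (0#1)];
           [:: r (0#1) (0#1); i ((-1)#2) (0#1)]]).

Definition x4 := fXof 2 c4 (fun j => fconj (c4 j)).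
(** t = 4 (sqrt 3 - 1)/3 = 1 - a^2 for a = 2/sqrt 3 - 1. *)
Definition t4 : Qs3i := (((-4)#3, 4#3), (0#1, 0#1)).

(** The tower adjoins sqrt 2, then beta with beta^2 = 2 alpha = -2 + 2 sqrt 2, then i. *)
Definition Qs2 := quad_ops (o := Qops) (2#1).
Definition Qs2b := quad_ops (o := Qs2) ((-2)#1, 2#1).
Definition Qs2bi := quad_ops (o := Qs2b) (((-1)#1, 0#1), (0#1, 0#1)).

(** [r a b] is a + b sqrt 2, [be a] is a beta, and [i a b] is (a + b sqrt 2) i, with alpha expanded
    as sqrt 2 - 1. *)
Definition c6 (j : nat) : nat -> nat -> Qs2bi :=
  let z : Qs2 := (0#1, 0#1) in
  let r a b : Qs2bi := (((a, b), z), (z, z)) in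
  let be a : Qs2bi := ((z, (a, (0#1))), (z, z)) in
  let i a b : Qs2bi := ((z, z), ((a, b), z)) in
  let o := r (0#1) (0#1) in
  ftable (if eqn j 0 then
    let a := r (0#1) (1#4) in let b := r (1#4) ((-1)#4) in
    [:: [:: a; o; b]; [:: o; a; b]; [:: b; b; a]]
  else if eqn j 1 then
    [:: [:: be ((-1)#1); o; o]; [:: o; be (1#1); o]; [:: o; o; o]]
  else
    let a := i ((-1)#1) (3#4) in let b := i ((-1)#4) (1#4) in
    [:: [:: o; a; b]; [:: a; o; b]; [:: b; b; i (1#1) ((-1)#4)]]).

Definition x6 := fXof 3 c6 (fun j => fconj (c6 j)).
(** t = sqrt 2 - 1/2 = 1 - a^2 for a = 1 - 1/sqrt 2. *)
Definition t6 : Qs2bi :=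
  ((((-1)#2, 1#1), (0#1, 0#1)), ((0#1, 0#1), (0#1, 0#1))).

(** * First levels, the minimal and the maximal set over the ball *)

Section Pauli.
Variable R : realType.
Local Notation C := R[i].

Ltac simp01 := rewrite ?(mulr1, mul1r, mulr0, mul0r, addr0, add0r, mulrN,
                         mulNr, opprK, oppr0).

Lemma conj_rc (x : R) : Num.conj (rc x) = rc x.
Proof. exact: conjc_real. Qed.

Lemma conj_ci : Num.conj (ci R) = - ci R.
Proof. by apply/eqP; rewrite eq_complex /= oppr0 !eqxx. Qed.

(* Restated since the general morphism lemmas leave [Num.conj] in a form that
   blocks further rewriting over [R[i]]. *)
Lemma cconjM (x y : C) : Num.conj (x * y) = Num.conj x * Num.conj y.
Proof. exact: rmorphM. Qed.

Lemma cconjN (x : C) : Num.conj (- x) = - Num.conj x.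
Proof. exact: rmorphN. Qed.

Lemma ci_sq : ci R * ci R = -1.
Proof.
by apply/eqP; rewrite eq_complex /= !mul0r !mulr1 mulr0 sub0r addr0 oppr0 !eqxx.
Qed.

Lemma mx2P (A B : 'M[C]_2) : A 0 0 = B 0 0 -> A 0 1 = B 0 1 ->
  A 1 0 = B 1 0 -> A 1 1 = B 1 1 -> A = B.
Proof.
move=> e00 e01 e10 e11; apply/matrixP => i j.
have two (k : 'I_2) : k = 0 \/ k = 1.
  by case: k => [[|[|k]] ?] //; [left | right]; apply: val_inj.
by case: (two i) => ->; case: (two j) => ->.
Qed.

Lemma mx2M a b c e a' b' c' e' :
  mx2 a b c e *m mx2 a' b' c' e' =
  mx2 (a * a' + b * c') (a * b' + b * e') (c * a' + e * c')
      (c * b' + e * e') :> 'M[C]_2.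
Proof. by apply: mx2P; rewrite !mxE !big_ord_recl big_ord0 !mxE /= addr0. Qed.

Lemma mx2D a b c e a' b' c' e' :
  mx2 a b c e + mx2 a' b' c' e' =
  mx2 (a + a') (b + b') (c + c') (e + e') :> 'M[C]_2.
Proof. by apply: mx2P; rewrite !mxE. Qed.

Lemma mx2Z k a b c e :
  k *: mx2 a b c e = mx2 (k * a) (k * b) (k * c) (k * e) :> 'M[C]_2.
Proof. by apply: mx2P; rewrite !mxE. Qed.

Lemma mx2N a b c e : - mx2 a b c e = mx2 (- a) (- b) (- c) (- e) :> 'M[C]_2.
Proof. by apply: mx2P; rewrite !mxE. Qed.

Lemma mx2_scalar a : a%:M = mx2 a 0 0 a :> 'M[C]_2.
Proof. by apply: mx2P; rewrite !mxE. Qed.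

Lemma mx2_adj a b c e :
  adj (mx2 a b c e) = mx2 (Num.conj a) (Num.conj c) (Num.conj b) (Num.conj e)
    :> 'M[C]_2.
Proof. by apply: mx2P; rewrite !mxE. Qed.

Lemma mx2_map (f : C -> C) a b c e :
  map_mx f (mx2 a b c e) = mx2 (f a) (f b) (f c) (f e) :> 'M[C]_2.
Proof. by apply: mx2P; rewrite !mxE. Qed.

Lemma sigma_z_adj : adj (sigma_z R) = sigma_z R.
Proof. by rewrite /sigma_z mx2_adj rmorphN !rmorph1 !rmorph0. Qed.

Lemma sigma_x_adj : adj (sigma_x R) = sigma_x R.
Proof. by rewrite /sigma_x mx2_adj !rmorph1 !rmorph0. Qed.

Lemma F3_hermitian j : Defs.hermitian (F3 R j).
Proof.
rewrite /Defs.hermitian /F3; case: ifP => _; last case: ifP => _;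
  by rewrite adj_tens ?adj1 ?sigma_z_adj ?sigma_x_adj.
Qed.

(** Mixed products cancel in pairs because sigma_z and sigma_x anticommute. *)
Lemma F3_clifford (x : 'I_3 -> C) (S := \sum_j x j *: F3 R j) :
  S *m S = (\sum_j x j ^+ 2)%:M.
Proof.
have zz : sigma_z R *m sigma_z R = 1%:M.
  by rewrite mx2M mx2_scalar; congr mx2; simp01.
have xx : sigma_x R *m sigma_x R = 1%:M.
  by rewrite mx2M mx2_scalar; congr mx2; simp01.
have zx : sigma_z R *m sigma_x R = - (sigma_x R *m sigma_z R).
  by rewrite /sigma_z /sigma_x !mx2M mx2N; congr mx2; simp01.
have SE : S = x 0 *: (sigma_z R *t sigma_z R) + (x 1 *: (sigma_x R *t sigma_z R)
    + x 2 *: (1%:M *t sigma_x R)).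
  rewrite /S !big_ord_recl big_ord0 addr0 /F3 /=.
  by congr (_ *: _ + (_ *: _ + _ *: _)); congr x; apply: val_inj.
have sE : \sum_j x j ^+ 2 = x 0 ^+ 2 + (x 1 ^+ 2 + x 2 ^+ 2).
  rewrite !big_ord_recl big_ord0 addr0.
  by congr (_ ^+ 2 + (_ ^+ 2 + _ ^+ 2)); congr x; apply: val_inj.
have tNl (A B : 'M[C]_2) : (- A) *t B = - (A *t B).
  by apply/matrixP => i j; rewrite !mxE mulNr.
rewrite SE sE !mulmxDl !mulmxDr -!scalemxAl -!scalemxAr !tensmx_mul.
rewrite !zz !xx !mul1mx !mulmx1 !tensmx11 zx !tNl !tensmxNr -[RHS]scalemx1.
move: 1%:M (_ *t 1%:M) (sigma_z R *t _) (sigma_x R *t _) => I A B D.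
by apply/matrixP => i j; rewrite !mxE; ring.
Qed.

Lemma tensmx_scalar1 d (A : 'M[C]_d) (a : C) :
  A *t (a%:M : 'M[C]_1) = (a *: A) *t (1%:M : 'M[C]_1).
Proof. by apply/matrixP => i j; rewrite !mxE; ring. Qed.

Lemma F3_pencil1 (x : 'I_3 -> R) (H := \sum_j F3 R j *t real_pt x j) :
  Defs.hermitian H /\ H *m H = (rc (\sum_j x j ^+ 2))%:M.
Proof.
have HE : H = (\sum_j rc (x j) *: F3 R j) *t (1%:M : 'M[C]_1).
  rewrite /H /real_pt; under eq_bigr do rewrite tensmx_scalar1.
  apply/matrixP => i j; rewrite !mxE !summxE mulr_suml.
  by apply: eq_bigr => k _; rewrite !mxE.
split.
  rewrite /Defs.hermitian adj_sum; apply: eq_bigr => j _.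
  by rewrite adj_tens F3_hermitian /real_pt adj_scalar conj_rc.
rewrite HE tensmx_mul mulmx1 F3_clifford -[X in X *t _]scalemx1.
have -> : \sum_j rc (x j) ^+ 2 = rc (\sum_j x j ^+ 2).
  by rewrite /rc rmorph_sum; apply: eq_bigr => j _; rewrite rmorphXn.
have tZl a (A : 'M[C]_(2 * 2)) :
    (a *: A) *t (1%:M : 'M[C]_1) = a *: (A *t (1%:M : 'M[C]_1)).
  by apply/matrixP => i j; rewrite !mxE mulrA.
by rewrite tZl tensmx11 scalemx1.
Qed.

Lemma hermitian1 (A : 'M[C]_1) :
  Defs.hermitian A -> A = (rc (complex.Re (A 0 0)))%:M.
Proof.
move=> hA; apply/matrixP => i j; rewrite !ord1 mxE eqxx mulr1n.
have /CrealP r : Num.conj (A 0 0) = A 0 0 by rewrite -{2}hA adjE.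
by rewrite /rc RRe_real.
Qed.

Lemma sa_tuple1 g (X : 'I_g -> 'M[C]_1) :
  sa_tuple X -> X = real_pt (fun j => complex.Re (X j 0 0)).
Proof. by move=> hX; apply: funext => j; exact: hermitian1. Qed.

Lemma real_pt_hermitian g (x : 'I_g -> R) : sa_tuple (real_pt x).
Proof. by move=> j; rewrite /Defs.hermitian /real_pt adj_scalar conj_rc. Qed.

Lemma psd_scalar n (a : C) : 0 <= a -> psd (a%:M : 'M[C]_n).
Proof. by move=> a0; rewrite -scalemx1; exact: psdZ a0 (psd1 _ n). Qed.

Lemma psd_diag n (A : 'M[C]_n) i : psd A -> 0 <= A i i.
Proof.
case=> _ /(_ (delta_mx i 0)); set B := _ *m _ *m _.
suff -> : B 0 0 = A i i by [].
have dE : adj (delta_mx i 0) = delta_mx 0 i :> 'rV[C]_n.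
  by rewrite /adj map_delta_mx trmx_delta.
by rewrite /B dE -rowE -colE !mxE.
Qed.

(** At level 1 the pencil is 1 - H with H^2 = |x|^2. Points of the ball are handled by
    [psd_of_square]; the converse compresses 1 - H by 1 + H. *)
Lemma first_level_F3 : first_level_is (spectrahedron (F3 R)) (@closed_ball3 R).
Proof.
move=> X; split=> [[hX pX]|[x [x1 ->]]]; last first.
  have [hH HH] := F3_pencil1 x; split; first exact: real_pt_hermitian.
  apply: psd_of_square => //; rewrite HH -raddfB; apply: psd_scalar.
  by rewrite subr_ge0 -(rmorph1 (real_complex R)) lecR.
have [x xE] : exists x, X = real_pt x by eexists; exact: sa_tuple1 hX.
rewrite xE in pX *.
exists x; split=> //.
have [] := F3_pencil1 x; set H := \sum_j _ in pX *.
set N := \sum_j x j ^+ 2 => hH HH.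
have h1 : adj (1%:M + H) = 1%:M + H by rewrite adjD adj1 hH.
have := psd_conj (1%:M + H) pX; rewrite h1.
have -> : (1%:M + H) *m (1%:M - H) *m (1%:M + H) = rc (1 - N) *: (1%:M + H).
  have -> : (1%:M + H) *m (1%:M - H) = (rc (1 - N))%:M.
    rewrite mulmxBr mulmx1 mulmxDl mul1mx HH opprD addrA addrK.
    by rewrite /rc rmorphB rmorph1 raddfB.
  exact: mul_scalar_mx.
(* At these two positions H has the opposite diagonal entries x_0 and -x_0, so adding them leaves 2
   (1 - |x|^2) >= 0. *)
move=> p; have p0 := psd_diag (mxtens_index (mxtens_index (0, 0), 0)) p.
have p1 := psd_diag (mxtens_index (mxtens_index (0, 1), 0)) p.
have Hd i : H (mxtens_index (mxtens_index (0, i), 0))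
    (mxtens_index (mxtens_index (0, i), 0)) = rc (x 0) * sigma_z R i i.
  rewrite /H summxE !big_ord_recl big_ord0 /F3 /= !tensmxE /real_pt.
  rewrite [sigma_z R 0 0]mxE [sigma_x R 0 0]mxE [sigma_x R i i]mxE.
  rewrite ![_%:M 0 0]mxE /=.
  rewrite !mulr1n mul1r !mul0r !addr0.
  have -> : nth 0 (nth [::] [:: [:: 0; 1]; [:: 1; 0]] i) i = 0 :> C.
    by case: i => [[|[|k]] ?].
  by rewrite mul0r !addr0 mul1r mulrC.
have : 0 <= rc (1 - N) * 2.
  apply: le_trans (addr_ge0 p0 p1) _.
  have en (M : 'M[C]_(2 * 2 * 1)) a i : (a *: (1%:M + M)) i i = a * (1 + M i i).
    by rewrite !mxE eqxx.
  rewrite !en !Hd ![sigma_z R _ _]mxE /= -mulrDr.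
  by have -> : 1 + rc (x 0) * 1 + (1 + rc (x 0) * -1) = 2 by ring.
rewrite pmulr_lge0 ?ltr0n // -(rmorph0 (real_complex R)) lecR subr_ge0; exact.
Qed.

Lemma Xof_hermitian m (Cs : 'I_3 -> 'M[C]_m) :
  (forall j, (Cs j)^T = Cs j) -> sa_tuple (Xof Cs).
Proof.
move=> sC j; rewrite /Defs.hermitian /Xof adj_block !adj0; congr block_mx.
  rewrite /adj !map_trmx sC; apply/matrixP => a b; rewrite !mxE; exact: conjcK.
by rewrite /adj map_trmx sC.
Qed.

End Pauli.

(** * The matrix convex hull of the ball and the failure of minimality *)

Section BallHull.
Variable R : realType.
Local Notation C := R[i].

(** Combinations of points of level 1 only. The index is an arbitrary finite type, so that nested
    combinations can be indexed by a dependent sum. *)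
Definition ball_hull : gset R 3 := fun n X =>
  exists (T : finType) (x : T -> 'I_3 -> R) (V : T -> 'rV[C]_n),
    [/\ forall t, closed_ball3 (x t), \sum_t adj (V t) *m V t = 1%:M
      & forall j, X j = \sum_t adj (V t) *m real_pt (x t) j *m V t].

(** Nested combinations compose: the pair (i, t) carries the point x_it and the coefficient W_it
    V_i. *)
Lemma ball_hull_mconv n k (d : 'I_k -> nat) (V : forall i, 'M[C]_(d i, n))
    (Y : forall i, 'I_3 -> 'M[C]_(d i)) :
  (forall i, ball_hull (Y i)) -> isometric_family V ->
  ball_hull (mconv_comb V Y).
Proof.
move=> hY isoV.
have [T [x [W hW]]] : exists (T : 'I_k -> finType)
    (x : forall i, T i -> 'I_3 -> R) (W : forall i, T i -> 'rV[C]_(d i)),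
  forall i, [/\ forall t, closed_ball3 (x i t),
      \sum_t adj (W i t) *m W i t = 1%:M
      & forall j, Y i j = \sum_t adj (W i t) *m real_pt (x i t) j *m W i t].
  exists (fun i => projT1 (cid (hY i))),
    (fun i => projT1 (cid (projT2 (cid (hY i))))),
    (fun i => projT1 (cid (projT2 (cid (projT2 (cid (hY i))))))) => i.
  exact: (projT2 (cid (projT2 (cid (projT2 (cid (hY i))))))).
exists ({i : 'I_k & T i} : finType), (fun p => x (tag p) (tagged p)),
  (fun p => W (tag p) (tagged p) *m V (tag p)); split.
- by move=> [i t]; case: (hW i) => bx _ _; exact: bx.
- rewrite -(sig_big_dep (fun _ => true) (fun _ _ => true)
    (fun i t => adj (W i t *m V i) *m (W i t *m V i))) -[RHS]isoV /=.
  apply: eq_bigr => i _; case: (hW i) => _ W1 _.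
  rewrite -(mulmx1 (adj (V i))) -W1 mulmx_sumr mulmx_suml.
  by apply: eq_bigr => t _; rewrite adjM !mulmxA.
- move=> j.
  rewrite -(sig_big_dep (fun _ => true) (fun _ _ => true)
    (fun i t => adj (W i t *m V i) *m real_pt (x i t) j *m (W i t *m V i))) /=.
  apply: eq_bigr => i _; case: (hW i) => _ _ ->.
  rewrite mulmx_sumr mulmx_suml.
  by apply: eq_bigr => t _; rewrite adjM !mulmxA.
Qed.

Lemma ball_hull_convex : matrix_convex ball_hull.
Proof.
split; last exact: ball_hull_mconv.
move=> n X [T [x [V [_ _ XE]]]] j; rewrite /Defs.hermitian XE adj_sum.
apply: eq_bigr => t _; rewrite !adjM adjK real_pt_hermitian mulmxA; done.
Qed.

Lemma ball_hull_sub (K : gset R 3) : matrix_convex K ->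
  first_level_is K (@closed_ball3 R) -> forall n X, ball_hull X -> K n X.
Proof.
move=> [_ convK] K1 n X [T [x [V [bx V1 XE]]]].
pose e (i : 'I_#|T|) : T := enum_val i.
have sumE (f : T -> 'M[C]_n) : \sum_t f t = \sum_i f (e i).
  by rewrite -(big_enum_val (A := T) f).
have -> : X = mconv_comb (d := fun=> 1%N) (fun i => V (e i))
    (fun i => real_pt (x (e i))).
  by apply: funext => j; rewrite XE sumE.
apply: convK; first by move=> i; apply/K1; exists (x (e i)).
by rewrite /isometric_family -(sumE (fun t => adj (V t) *m V t)).
Qed.

(** The set K bounds the first level of the hull from above, because it contains the hull; one-term
    combinations give the other inclusion. *)
Lemma ball_hull_first_level (K : gset R 3) : matrix_convex K ->
  first_level_is K (@closed_ball3 R) ->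
  first_level_is ball_hull (@closed_ball3 R).
Proof.
move=> convK K1 X; split=> [/(ball_hull_sub convK K1)/K1 //|[x [bx ->]]].
exists unit, (fun=> x), (fun=> 1%:M); split=> // [|j].
  by rewrite big_const card_unit /= adj1 mulmx1 addr0.
by rewrite big_const card_unit /= adj1 mulmx1 mul1mx addr0.
Qed.

(** Minimality would place X in the hull. Extremality then makes a 1 x 1 point unitarily equivalent
    to X or X + Z, of size at least n > 1. *)
Lemma free_extreme_not_min (K : gset R 3) n (X : 'I_3 -> 'M[C]_n) :
  (1 < n)%N -> free_extreme K X -> ~ is_min_over K (@closed_ball3 R).
Proof.
move=> n1 [KX extX] [convK [K1 minK]].
have [T [x [V [bx V1 XE]]]] :=
  minK _ ball_hull_convex (ball_hull_first_level convK K1) n X KX.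
pose A := [pred t | V t != 0].
(* Extremality speaks of nonzero coefficients only, so the vanishing ones are removed first. *)
have drop (f : T -> 'M[C]_n) : (forall t, V t = 0 -> f t = 0) ->
    \sum_t f t = \sum_(i < #|A|) f (enum_val i).
  move=> f0; rewrite -(big_enum_val (A := A) f) [LHS](bigID A) /=.
  rewrite [X in _ + X]big1 ?addr0 //.
  by move=> t; rewrite negbK => /eqP/f0.
have V1' : isometric_family (d := fun _ : 'I_#|A| => 1%N)
    (fun i => V (enum_val i)).
  rewrite /isometric_family -[RHS]V1 (drop (fun t => adj (V t) *m V t)) //.
  by move=> t ->; rewrite mulmx0.
have ext := extX _ (fun=> 1%N) (fun i => V (enum_val i))
  (fun i => real_pt (x (enum_val i))).
(* An empty sum cannot be the identity of size n > 0. *)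
have A0 : (0 < #|A|)%N.
  rewrite lt0n; apply/negP => /eqP A0; move: V1'.
  rewrite /isometric_family big1 => [/matrixP|l]; last first.
    by have := ltn_ord l; rewrite {2}A0.
  move/(_ (Ordinal (ltnW n1)) (Ordinal (ltnW n1)))/eqP.
  by rewrite !mxE eqxx eq_sym oner_eq0.
case: (ext A _ _ V1' _ (Ordinal A0)).
- by move=> l; have := enum_valP l; rewrite inE.
- by move=> l; apply/K1; exists (x (enum_val l)).
- apply: funext => j; rewrite XE /mconv_comb.
  apply: (drop (fun t => adj (V t) *m real_pt (x t) j *m V t)) => t ->.
  by rewrite mulmx0.
- by move=> [U [/isometry_le]]; rewrite leqNgt n1.
- move=> [m [Z [_ [U [/isometry_le]]]]].
  by rewrite leqNgt (leq_trans n1) // leq_addr.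
Qed.

End BallHull.

(** * The polar of the ball and the failure of maximality for the matrix range *)

Section BallPolar.
Variable R : realType.
Local Notation C := R[i].

(** A matrix convex set defined by scalar linear inequalities; its first level is the ball because
    the ball is its own polar. *)
Definition ball_polar : gset R 3 := fun n Y =>
  sa_tuple Y /\
  forall x, closed_ball3 x -> psd (1%:M - \sum_j rc (x j) *: Y j).

Lemma ball_polar_convex : matrix_convex ball_polar.
Proof.
split=> [n X [] //|n k d V Y hY isoV]; split.
  move=> j; rewrite /Defs.hermitian adj_sum; apply: eq_bigr => i _.
  by rewrite !adjM adjK (proj1 (hY i)) mulmxA.
move=> x bx; have -> : 1%:M - \sum_j rc (x j) *: mconv_comb V Y j =
    \sum_i adj (V i) *m (1%:M - \sum_j rc (x j) *: Y i j) *m V i.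
  under [RHS]eq_bigr do rewrite mulmxBr mulmxBl mulmx1.
  rewrite sumrB isoV; congr (_ - _).
  under eq_bigr do rewrite scaler_sumr.
  rewrite exchange_big; apply: eq_bigr => i _.
  rewrite mulmx_sumr mulmx_suml; apply: eq_bigr => j _.
  by rewrite -scalemxAr -scalemxAl.
by apply: psd_sum => i _; apply: psd_conj; case: (hY i) => _; apply.
Qed.

Lemma ball_polar_first_level : first_level_is ball_polar (@closed_ball3 R).
Proof.
have sumE (x y : 'I_3 -> R) :
    1%:M - \sum_j rc (x j) *: real_pt y j = (rc (1 - \sum_j x j * y j))%:M.
  have rcE : rc (1 - \sum_j x j * y j) = 1 - \sum_j rc (x j) * rc (y j).
    by rewrite /rc rmorphB rmorph1 rmorph_sum; under eq_bigr do rewrite rmorphM.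
  rewrite rcE (raddfB (@scalar_mx C 1)) (raddf_sum (@scalar_mx C 1)) /=.
  by under eq_bigr do rewrite scale_scalar_mx.
move=> Y; split=> [[hY pY]|[y [y1 ->]]]; last first.
  split=> [|x x1]; first exact: real_pt_hermitian.
  rewrite sumE; apply: psd_scalar; rewrite ler0c subr_ge0.
  have : \sum_j x j * y j <= 2^-1 * (\sum_j x j ^+ 2 + \sum_j y j ^+ 2).
    rewrite -big_split mulr_sumr; apply: ler_sum => j _ /=.
    by have := sqr_ge0 (x j - y j); lra.
  by rewrite /closed_ball3 in x1 y1; lra.
have [y yE] : exists y, Y = real_pt y by eexists; exact: sa_tuple1 hY.
rewrite yE in pY *; exists y; split=> //.
rewrite /closed_ball3; set N := \sum_j _; have N0 : 0 <= N.
  by apply: sumr_ge0 => j _; exact: sqr_ge0.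
have N1 : 0 < 1 + N by lra.
(* A square-root-free substitute for y/|y|: x lies in the ball as 4 N <= (1 + N)^2, and x . y = 2
   N/(1 + N) <= 1 forces N <= 1. *)
pose x j := 2 / (1 + N) * y j.
have : closed_ball3 x.
  rewrite /closed_ball3 /x; under eq_bigr do rewrite exprMn.
  rewrite -mulr_sumr -/N expr_div_n mulrAC ler_pdivrMr ?exprn_gt0 // mul1r.
  by have := sqr_ge0 (1 - N); nra.
move/pY; rewrite sumE => /(psd_diag 0); rewrite mxE eqxx mulr1n ler0c.
have -> : \sum_j x j * y j = 2 / (1 + N) * N.
  by rewrite mulr_sumr; apply: eq_bigr => j _; rewrite /x -mulrA -expr2.
rewrite subr_ge0 mulrAC ler_pdivrMr // mul1r; lra.
Qed.

Lemma lin_map_affine d n (phi : 'M[C]_d -> 'M[C]_n) (a : C) (c : 'I_3 -> C)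
    A F :
  lin_map phi -> phi (a *: A - \sum_j c j *: F j) =
  a *: phi A - \sum_j c j *: phi (F j).
Proof.
move=> lin; rewrite lin -!sumrN; congr (_ + _).
have phi0 : phi 0 = 0.
  have := lin 1 0 0; rewrite !scale1r addr0 => /eqP.
  by rewrite -subr_eq0 opprD addNKr oppr_eq0 => /eqP.
elim/big_rec2: _ => [//|j y M _ <-].
by rewrite -!scaleNr lin.
Qed.

Lemma tens_delta k n (X : 'M[C]_k) (F : 'M[C]_n) :
  \sum_p \sum_q delta_mx p q *t (X p q *: F) = X *t F.
Proof.
have tDl (A B : 'M[C]_k) : (A + B) *t F = A *t F + B *t F.
  by apply/matrixP => i j; rewrite !mxE mulrDl.
have tsl I (r : seq I) (P : pred I) (G : I -> 'M[C]_k) :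
    (\sum_(i <- r | P i) G i) *t F = \sum_(i <- r | P i) G i *t F.
  exact: (big_morph (fun A => A *t F) tDl (tens0mx F)).
rewrite [in RHS](matrix_sum_delta X) tsl; apply: eq_bigr => p _.
rewrite tsl; apply: eq_bigr => q _.
by apply/matrixP => i j; rewrite !mxE; ring.
Qed.

(** The k-th ampliation of phi maps 1 - sum X_j (x) F_j to 1 - sum X_j (x) phi(F_j). *)
Lemma matrix_range_pairing d n k (F : 'I_3 -> 'M[C]_d) (Y : 'I_3 -> 'M[C]_n)
    (X : 'I_3 -> 'M[C]_k) :
  matrix_range F Y -> psd (1%:M - \sum_j X j *t F j) ->
  psd (1%:M - \sum_j X j *t Y j).
Proof.
move=> [phi [[lin [unit cp]] ->]].
(* The block form required by [cp_map]. Keeping G general lets it be used both for 1 and for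
   phi(1). *)
have E m (G : 'M[C]_m) (H : 'I_3 -> 'M[C]_m) : G = 1%:M ->
    1%:M - \sum_j X j *t H j =
    \sum_p \sum_q delta_mx p q *t
      ((1%:M : 'M[C]_k) p q *: G - \sum_j X j p q *: H j).
  move=> G1.
  under [RHS]eq_bigr do under eq_bigr do rewrite tensmxDr tensmxNr tensmx_sumr.
  under [RHS]eq_bigr do rewrite sumrB.
  rewrite sumrB tens_delta G1 tensmx11; congr (_ - _).
  under eq_bigr do rewrite -tens_delta.
  rewrite exchange_big; apply: eq_bigr => p _.
  by rewrite exchange_big.
rewrite (E _ _ _ erefl) => /cp.
rewrite (E _ _ (fun j => phi (F j)) unit).
congr psd; apply: eq_bigr => p _; apply: eq_bigr => q _.
by rewrite lin_map_affine.
Qed.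

Lemma matrix_range_not_max d k n (F : 'I_3 -> 'M[C]_d) (X : 'I_3 -> 'M[C]_k)
    (Y : 'I_3 -> 'M[C]_n) :
  psd (1%:M - \sum_j X j *t F j) -> ~ psd (1%:M - \sum_j X j *t Y j) ->
  ball_polar Y -> ~ is_max_over (matrix_range F) (@closed_ball3 R).
Proof.
move=> pX npY BY [_ [_ maxF]]; apply: npY; apply: matrix_range_pairing pX.
exact: maxF ball_polar_convex ball_polar_first_level _ _ BY.
Qed.

(* The witness: C(y) = [[y1 + i y3/2, y2/2], [y2/2, y1/2 - i y3]] satisfies
   |y|^2 - C(y) C(y)^* = (3/4) g^* g with g = [[y2, -y1], [y3, -i y2]]. *)
Definition witness_block : 'I_3 -> 'M[C]_2 := fun j =>
  if val j == 0%N then mx2 1 0 0 (2^-1)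
  else if val j == 1%N then mx2 0 (2^-1) (2^-1) 0
  else mx2 (ci R / 2) 0 0 (- ci R).

Lemma witness_polar : ball_polar (Xof witness_block).
Proof.
have symW j : (witness_block j)^T = witness_block j.
  rewrite /witness_block; case: ifP => _; last case: ifP => _;
    by apply: mx2P; rewrite !mxE.
split=> [|y by1]; first exact: Xof_hermitian.
pose a := rc (y 0); pose b := rc (y 1); pose e := rc (y 2); pose i := ci R.
set H := \sum_j _.
have h2 : Num.conj (2^-1 : C) = 2^-1 by rewrite fmorphV rmorph_nat.
have HE : H = block_mx 0 (mx2 (a + i * e / 2) (b / 2) (b / 2) (a / 2 - i * e))
                 (mx2 (a - i * e / 2) (b / 2) (b / 2) (a / 2 + i * e)) 0.
  rewrite /H !big_ord_recl big_ord0 addr0 /Xof /witness_block /=.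
  rewrite -/(rc (y ord0)) !mx2_map !scale_block_mx !scaler0 !add_block_mx !addr0.
  have -> : conjc (2^-1 : C) = 2^-1 by exact: h2.
  have hi2 : Num.conj (i / 2) = - i / 2 by rewrite cconjM conj_ci h2.
  have hNi : Num.conj (- i) = i by rewrite cconjN conj_ci opprK.
  have -> : conjc (ci R / 2) = - i / 2 by exact: hi2.
  have -> : conjc (- ci R) = i by exact: hNi.
  have -> : y ord0 = y 0 by [].
  have -> : lift ord0 (ord0 : 'I_2) = 1 :> 'I_3 by exact: val_inj.
  have -> : lift ord0 (lift ord0 (ord0 : 'I_1)) = 2 :> 'I_3 by exact: val_inj.
  rewrite ?rmorph0 ?rmorph1 !mx2Z !mx2D; congr block_mx; congr mx2;
    by rewrite -/a -/b -/e /i; ring.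
have hH : Defs.hermitian H.
  rewrite /Defs.hermitian adj_sum; apply: eq_bigr => j _.
  by rewrite adjZ conj_rc Xof_hermitian.
apply: psd_of_square => //.
pose G : 'M[C]_(2 + 2) :=
  block_mx (mx2 b (- a) e (- i * b)) 0 0 (mx2 b (- a) e (i * b)).
(* H^2 is block diagonal with blocks C(y) C(y)^* and its conjugate, so the identity for C(y) applies
   to each block; |y| <= 1 makes the scalar part nonnegative. *)
have -> : 1%:M - H *m H =
    (rc (1 - \sum_j y j ^+ 2))%:M + (3 / 4) *: (adj G *m G).
  have NE : rc (1 - \sum_j y j ^+ 2) = 1 - (a ^+ 2 + b ^+ 2 + e ^+ 2).
    rewrite /rc rmorphB rmorph1 rmorph_sum !big_ord_recl big_ord0 addr0.
    rewrite !rmorphXn addrA.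
    congr (1 - (_ ^+ 2 + _ ^+ 2 + _ ^+ 2)); congr (_ _); congr y;
      exact: val_inj.
  have [ca cb ce] : [/\ Num.conj a = a, Num.conj b = b & Num.conj e = e].
    by split; exact: conj_rc.
  have i2 : i * i = -1 by exact: ci_sq.
  rewrite HE /G adj_block !adj0 !mx2_adj !cconjM !cconjN ca cb ce conj_ci NE.
  rewrite !mulmx_block !mul0mx !mulmx0 !addr0 !add0r scale_block_mx !scaler0.
  rewrite !scalar_mx_block -/i !mx2M !mx2Z !mx2_scalar !opp_block_mx.
  rewrite !add_block_mx.
  rewrite !oppr0 !addr0 !mx2N !mx2D.
  by congr block_mx; congr mx2; field: i2.
apply: psdD.
  by apply: psd_scalar; rewrite ler0c subr_ge0.
by apply: psdZ; [rewrite divr_ge0 ?ler0n | exact: psd_gram].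
Qed.

End BallPolar.

(** * Application of the certificates *)

Section Certificate.
Variables (R : realType) (o : numops) (ev : o -> R[i]).
Hypothesis evP : numspec ev.
Local Notation C := R[i].

Lemma repr_mx2 (a b c e : o) :
  repr ev (mx2 (ev a) (ev b) (ev c) (ev e)) (ftable [:: [:: a; b]; [:: c; e]]).
Proof. by move=> [[|[|i]] ?] // [[|[|j]] ?] //; rewrite mxE. Qed.

Lemma repr_mx3 (a b c a' b' c' a'' b'' c'' : o) :
  repr ev (mx3 (ev a) (ev b) (ev c) (ev a') (ev b') (ev c')
               (ev a'') (ev b'') (ev c''))
    (ftable [:: [:: a; b; c]; [:: a'; b'; c']; [:: a''; b''; c'']]).
Proof. by move=> [[|[|[|i]]] ?] // [[|[|[|j]]] ?] //; rewrite mxE. Qed.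

Lemma repr_F3 j : repr ev (F3 R j) (fF3 o j).
Proof.
have rz : repr ev (sigma_z R)
    (ftable [:: [:: n1 o; n0 o]; [:: n0 o; nopp (n1 o)]]).
  have -> : sigma_z R =
      mx2 (ev (n1 o)) (ev (n0 o)) (ev (n0 o)) (ev (nopp (n1 o))).
    by rewrite (evN evP) (ev1 evP) (ev0 evP).
  exact: repr_mx2.
have rx : repr ev (sigma_x R) (ftable [:: [:: n0 o; n1 o]; [:: n1 o; n0 o]]).
  have -> : sigma_x R = mx2 (ev (n0 o)) (ev (n1 o)) (ev (n1 o)) (ev (n0 o)).
    by rewrite (ev1 evP) (ev0 evP).
  exact: repr_mx2.
rewrite /F3 /fF3 -[eqn j 0]/(val j == 0%N) -[eqn j 1]/(val j == 1%N).
case: ifP => _; last case: ifP => _; apply: (repr_tens evP) => //.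
by apply: (repr_scalar evP); rewrite (ev1 evP).
Qed.

Lemma repr_Xof m (Cs : 'I_3 -> 'M[C]_m) (c cbar : nat -> nat -> nat -> o) :
  (forall j, repr ev (Cs j) (c j)) ->
  (forall j, repr ev (map_mx conjc (Cs j)) (cbar j)) ->
  forall j, repr ev (Xof Cs j) (fXof m c cbar j).
Proof.
move=> rC rC' j; have r0 : repr ev (0 : 'M_m) (fconst0 o).
  by move=> a b; rewrite mxE (ev0 evP).
exact: (repr_block r0 (rC j) (rC' j) r0).
Qed.

Lemma tens_hermitian m n (A : 'I_3 -> 'M[C]_m) (X : 'I_3 -> 'M[C]_n) :
  sa_tuple A -> sa_tuple X -> Defs.hermitian (\sum_j A j *t X j).
Proof.
move=> hA hX; rewrite /Defs.hermitian adj_sum; apply: eq_bigr => j _.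
by rewrite adj_tens hA hX.
Qed.

(** Transfers a successful computation to the criterion, with the kernel matrix taken from
    [quartic_kernel]. *)
Lemma certificate_free_extreme n (X : 'I_3 -> 'M[C]_n.+1)
    (fX : nat -> nat -> nat -> o) t :
  sa_tuple X -> (forall j, repr ev (X j) (fX j)) -> 0 < ev t ->
  certificate n.+1 fX t ->
  spectrahedron (F3 R) X /\ free_extreme (spectrahedron (F3 R)) X.
Proof.
move=> hX rX t0 /and3P[]; set h := tab _ _ _ => ckQ ckD ckC.
pose H := \sum_j F3 R j *t X j.
have rH : repr ev H h.
  exact/(@repr_tab _ _ _ _ _ H)/(repr_pencil evP repr_F3 rX).
have HQ := quartic_checkP evP rH ckQ.
have DX : spectrahedron (F3 R) X.
  split=> //; apply: (psd_of_quartic HQ) => //.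
  exact: tens_hermitian (@F3_hermitian R) hX.
split=> //; apply: (free_extreme_criterion DX (quartic_kernel HQ)).
  by move=> b; exact: (dilation_checkP evP repr_F3 rH ckD).
by move=> P; exact: (commutant_checkP evP rX ckC).
Qed.

End Certificate.

(** * Evaluation of the number towers and verification of the explicit tuples *)

Section Instances.
Variable R : realType.
Local Notation C := R[i].

Lemma s3_sq : rc (s3 R) ^+ 2 = 3.
Proof. by rewrite /rc -rmorphXn /s3 sqr_sqrtr ?ler0n // rmorph_nat. Qed.

Lemma evQ0 p : evQ C (Qmake Z0 p) = 0.
Proof. by rewrite /evQ /zev /= mul0r. Qed.

Lemma evQ_pos a p :
  evQ C (Qmake (Zpos a) p) = (Pos.to_nat a)%:R / (Pos.to_nat p)%:R.
Proof. by []. Qed.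

Lemma evQ_neg a p :
  evQ C (Qmake (Zneg a) p) = - (Pos.to_nat a)%:R / (Pos.to_nat p)%:R.
Proof.
rewrite mulNr; exact: (evN (evQ_spec C) (Qmake (Zpos a) p)).
Qed.

Ltac eval_Q :=
  rewrite ?(evQ0, evQ_pos, evQ_neg);
  repeat match goal with |- context [Pos.to_nat ?p] =>
    let n := eval vm_compute in (Pos.to_nat p) in change (Pos.to_nat p) with n
  end.

Definition ev_s3 : Qs3 -> C := @quad_ev C Qops (3#1) (@evQ C) (rc (s3 R)).
Definition ev_s3i : Qs3i -> C := @quad_ev C Qs3 ((-1)#1, 0#1) ev_s3 (ci R).

Lemma ev_s3P : numspec ev_s3.
Proof.
apply: quad_spec; first exact: evQ_spec.
by rewrite s3_sq; eval_Q; rewrite divr1.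
Qed.

Lemma ev_s3iP : numspec ev_s3i.
Proof.
apply: quad_spec; first exact: ev_s3P.
by rewrite expr2 ci_sq /ev_s3 /quad_ev /=; eval_Q; rewrite divr1 mul0r addr0.
Qed.

Lemma s3_neq0 : rc (s3 R) != 0.
Proof. by rewrite -sqrf_eq0 s3_sq pnatr_eq0. Qed.

Lemma s3V : (rc (s3 R))^-1 = rc (s3 R) / 3.
Proof.
apply: (mulfI s3_neq0); rewrite divff ?s3_neq0 //.
by rewrite mulrA -expr2 s3_sq divff // pnatr_eq0.
Qed.

Lemma rcD (p q : R) : rc (p + q) = rc p + rc q. Proof. exact: rmorphD. Qed.
Lemma rcM (p q : R) : rc (p * q) = rc p * rc q. Proof. exact: rmorphM. Qed.
Lemma rcN (p : R) : rc (- p) = - rc p. Proof. exact: rmorphN. Qed.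
Lemma rcV (p : R) : rc (p^-1) = (rc p)^-1. Proof. exact: fmorphV. Qed.
Lemma rc1 : rc (1 : R) = 1. Proof. exact: rmorph1. Qed.
Lemma rcn n : rc (n%:R : R) = n%:R. Proof. exact: rmorph_nat. Qed.

Lemma conj_evQ q : Num.conj (evQ C q) = evQ C q.
Proof.
have conjZ z : Num.conj (zev C z) = zev C z by exact: rmorph_int.
by apply: etrans (fmorph_div _ _ _) _; congr (_ / _); exact: conjZ.
Qed.

(** Adjoining a real root keeps all values real; this is used layer by layer below i. *)
Lemma conj_quad (o : numops) (d : o) (ev : o -> C) (r : C) :
  (forall a, Num.conj (ev a) = ev a) -> Num.conj r = r ->
  forall a, Num.conj (@quad_ev C o d ev r a) = quad_ev ev r a.
Proof.
move=> evR rR a; apply: etrans (rmorphD _ _ _) _.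
congr (_ + _); first exact: evR.
by apply: etrans (rmorphM _ _ _) _; congr (_ * _); first exact: evR.
Qed.

Lemma repr_conj (o : numops) (d : o) (ev : o -> C) m n (A : 'M[C]_(m, n)) f :
  numspec ev -> (forall a, Num.conj (ev a) = ev a) ->
  repr (@quad_ev C o d ev (ci R)) A f ->
  repr (@quad_ev C o d ev (ci R)) (map_mx conjc A) (fconj f).
Proof.
move=> evP evR rA i j; rewrite mxE rA -[LHS]/(Num.conj _) /quad_ev /fconj /=.
rewrite (evN evP) -[LHS]/(Num.conj (ev (f i j).1 + ev (f i j).2 * ci R)).
have cD (x y : C) : Num.conj (x + y) = Num.conj x + Num.conj y.
  exact: rmorphD.
by rewrite cD cconjM !evR conj_ci mulrN mulNr.
Qed.

Lemma repr_C4 j : repr ev_s3i (C4 R j) (c4 j).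
Proof.
rewrite /C4 /c4 -[eqn j 0]/(val j == 0%N) -[eqn j 1]/(val j == 1%N).
have s2 := s3_sq.
case: ifP => _; last case: ifP => _; rewrite mx2Z.
(* Each entry is replaced by the value of its representation, which leaves one field identity per
   entry. *)
all: match goal with
  |- repr _ (mx2 ?a ?b ?c ?e) (ftable [:: [:: ?a'; ?b']; [:: ?c'; ?e']]) =>
  have -> : mx2 a b c e = mx2 (ev_s3i a') (ev_s3i b') (ev_s3i c') (ev_s3i e')
  end; last exact: repr_mx2.
all: congr mx2; rewrite /ev_s3i /ev_s3 /quad_ev /=; eval_Q.
all: rewrite ?(rcD, rcM, rcN, rcV, rc1, rcn, mul0r, mulr0, addr0, add0r, s3V).
all: by field: s2.
Qed.

Lemma sqrt2_sq : rc (Num.sqrt 2 : R) ^+ 2 = 2.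
Proof. by rewrite /rc -rmorphXn sqr_sqrtr ?ler0n // rmorph_nat. Qed.

Lemma beta_sq : rc (beta R) ^+ 2 = 2 * rc (Num.sqrt 2) - 2.
Proof.
have b2 : beta R ^+ 2 = 2 * alpha R.
  rewrite sqr_sqrtr // mulr_ge0 ?ler0n // subr_ge0 -{1}(sqrtr1 R).
  by rewrite ler_sqrt ?ler0n // ler1n.
by rewrite expr2 -rcM -expr2 b2 /alpha !(rcM, rcD, rcN, rc1, rcn) mulrBr mulr1.
Qed.

Definition ev_s2 : Qs2 -> C := @quad_ev C Qops (2#1) (@evQ C) (rc (Num.sqrt 2)).
Definition ev_s2b : Qs2b -> C :=
  @quad_ev C Qs2 ((-2)#1, 2#1) ev_s2 (rc (beta R)).
Definition ev_s2bi : Qs2bi -> C :=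
  @quad_ev C Qs2b (((-1)#1, 0#1), (0#1, 0#1)) ev_s2b (ci R).

Lemma ev_s2P : numspec ev_s2.
Proof.
apply: quad_spec; first exact: evQ_spec.
by rewrite sqrt2_sq; eval_Q; rewrite divr1.
Qed.

Lemma ev_s2bP : numspec ev_s2b.
Proof.
apply: quad_spec; first exact: ev_s2P.
by rewrite beta_sq /ev_s2 /quad_ev /=; eval_Q; rewrite !divr1 addrC.
Qed.

Lemma ev_s2biP : numspec ev_s2bi.
Proof.
apply: quad_spec; first exact: ev_s2bP.
rewrite expr2 ci_sq /ev_s2b /ev_s2 /quad_ev /=; eval_Q.
by rewrite divr1 !(mul0r, addr0).
Qed.

Lemma repr_C6 j : repr ev_s2bi (C6 R j) (c6 j).
Proof.
have mx3Z k a b c a' b' c' a'' b'' c'' : k *: mx3 a b c a' b' c' a'' b'' c'' =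
    mx3 (k * a) (k * b) (k * c) (k * a') (k * b') (k * c')
        (k * a'') (k * b'') (k * c'') :> 'M[C]_3.
  by apply/matrixP => -[[|[|[|u]]] ?] // -[[|[|[|v]]] ?] //; rewrite !mxE.
rewrite /C6 /c6 -[eqn j 0]/(val j == 0%N) -[eqn j 1]/(val j == 1%N).
case: ifP => _; last case: ifP => _; rewrite mx3Z.
all: match goal with
  |- repr _ (mx3 ?a ?b ?c ?d ?e ?f ?g ?h ?k)
    (ftable [:: [:: ?a'; ?b'; ?c']; [:: ?d'; ?e'; ?f']; [:: ?g'; ?h'; ?k']]) =>
  have -> : mx3 a b c d e f g h k =
    mx3 (ev_s2bi a') (ev_s2bi b') (ev_s2bi c') (ev_s2bi d') (ev_s2bi e')
        (ev_s2bi f') (ev_s2bi g') (ev_s2bi h') (ev_s2bi k')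
  end; last exact: repr_mx3.
all: congr mx3; rewrite /ev_s2bi /ev_s2b /ev_s2 /quad_ev /=; eval_Q.
all: rewrite /alpha ?(rcD, rcM, rcN, rcV, rc1, rcn, mul0r, mulr0, addr0, add0r).
all: by field.
Qed.

Lemma C4_sym j : (C4 R j)^T = C4 R j.
Proof.
apply/matrixP => u v; rewrite mxE !repr_C4 /c4.
by case: eqn; last case: eqn; case: u => [[|[|u]] ?] //; case: v => [[|[|v]] ?].
Qed.

Lemma C6_sym j : (C6 R j)^T = C6 R j.
Proof.
apply/matrixP => u v; rewrite mxE !repr_C6 /c6.
by case: eqn; last case: eqn; case: u => [[|[|[|u]]] ?] //;
  case: v => [[|[|[|v]]] ?].
Qed.

Lemma repr_X4 j : repr ev_s3i (X4 R j) (x4 j).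
Proof.
apply: (repr_Xof ev_s3iP repr_C4) => {}j.
apply: (repr_conj ev_s3P) (repr_C4 j) => a.
by apply: conj_quad => [b|]; [exact: conj_evQ | exact: conj_rc].
Qed.

Lemma repr_X6 j : repr ev_s2bi (X6 R j) (x6 j).
Proof.
apply: (repr_Xof ev_s2biP repr_C6) => {}j.
apply: (repr_conj ev_s2bP) (repr_C6 j) => a.
apply: conj_quad => [b|]; last exact: conj_rc.
by apply: conj_quad => [c|]; [exact: conj_evQ | exact: conj_rc].
Qed.

Lemma real_sqrt3 : 1 < s3 R.
Proof. by rewrite /s3 -{1}(sqrtr1 R) ltr_sqrt ?ltr0n // ltr1n. Qed.

Lemma t4_gt0 : 0 < ev_s3i t4.
Proof.
rewrite /ev_s3i /ev_s3 /quad_ev /=; eval_Q; rewrite ?(mul0r, addr0, divr1).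
have -> : - 4 / 3 + 4 / 3 * rc (s3 R) = rc (4 / 3 * (s3 R - 1)).
  by rewrite !(rcM, rcD, rcN, rcV, rc1, rcn); field.
by rewrite ltcE /= eqxx /=; have := real_sqrt3; lra.
Qed.

Lemma X4_free_extreme : spectrahedron (F3 R) (X4 R) /\
  free_extreme (spectrahedron (F3 R)) (X4 R).
Proof.
(* [n := 3] means size 4, since the certificate lemma speaks of size [n.+1]. *)
apply: (certificate_free_extreme (n := 3) (t := t4) ev_s3iP _ repr_X4).
- exact: Xof_hermitian C4_sym.
- exact: t4_gt0.
- by vm_compute.
Qed.

Lemma X6_free_extreme : spectrahedron (F3 R) (X6 R) /\
  free_extreme (spectrahedron (F3 R)) (X6 R).
Proof.
apply: (certificate_free_extreme (n := 5) (t := t6) ev_s2biP _ repr_X6).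
- exact: Xof_hermitian C6_sym.
- rewrite /ev_s2bi /ev_s2b /ev_s2 /quad_ev /=; eval_Q.
  rewrite ?(mul0r, addr0, divr1).
  have -> : - 1 / 2 + 1 * rc (Num.sqrt 2) = rc (Num.sqrt 2 - 1 / 2 : R).
    by rewrite !(rcM, rcD, rcN, rcV, rc1, rcn); field.
  have : 1 < Num.sqrt 2 :> R by rewrite -{1}(sqrtr1 R) ltr_sqrt ?ltr0n // ltr1n.
  by rewrite ltcE /= eqxx /=; lra.
- by vm_compute.
Qed.

Definition c_witness (j : nat) : nat -> nat -> Qs3i :=
  let r a : Qs3i := ((a, 0#1), (0#1, 0#1)) in
  let i a : Qs3i := ((0#1, 0#1), (a, 0#1)) in
  ftable (if eqn j 0 then [:: [:: r (1#1); r (0#1)]; [:: r (0#1); r (1#2)]]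
  else if eqn j 1 then [:: [:: r (0#1); r (1#2)]; [:: r (1#2); r (0#1)]]
  else [:: [:: i (1#2); r (0#1)]; [:: r (0#1); i ((-1)#1)]]).

Lemma repr_witness j : repr ev_s3i (witness_block R j) (c_witness j).
Proof.
rewrite /witness_block /c_witness.
rewrite -[eqn j 0]/(val j == 0%N) -[eqn j 1]/(val j == 1%N).
case: ifP => _; last case: ifP => _.
all: match goal with
  |- repr _ (mx2 ?a ?b ?c ?e) (ftable [:: [:: ?a'; ?b']; [:: ?c'; ?e']]) =>
  have -> : mx2 a b c e = mx2 (ev_s3i a') (ev_s3i b') (ev_s3i c') (ev_s3i e')
  end; last exact: repr_mx2.
all: by congr mx2; rewrite /ev_s3i /ev_s3 /quad_ev /=; eval_Q; field.
Qed.

Definition y4 := fXof 2 c_witness (fun j => fconj (c_witness j)).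

Lemma repr_y4 j : repr ev_s3i (Xof (witness_block R) j) (y4 j).
Proof.
apply: (repr_Xof ev_s3iP repr_witness) => {}j.
apply: (repr_conj ev_s3P) (repr_witness j) => a.
by apply: conj_quad => [b|]; [exact: conj_evQ | exact: conj_rc].
Qed.

(* The coordinates (x, y) of the test vector: 4 on the pairs that couple the
   first rows of both blocks, 3 on those that couple the second rows. *)
Definition test_vec (i j : nat) : Qs3i :=
  nth (n0 Qs3i) [seq ((a, 0#1), (0#1, 0#1)) | a <-
    [:: 0#1; 0#1; 4#1; 0#1;  0#1; 0#1; 0#1; 3#1;
        4#1; 0#1; 0#1; 0#1;  0#1; 3#1; 0#1; 0#1]] i.

(** 51/2 - (91/6) sqrt 3, which is negative since 153^2 < 3 * 91^2. *)
Definition test_value : Qs3i := ((51#2, (-91)#6), (0#1, 0#1)).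

(** The pairing has X4 as left factor. The quartic identity is recomputed in this order, with the
    same t, instead of conjugating by the flip. *)
Lemma X4_flip_psd : psd (1%:M - \sum_j X4 R j *t F3 R j).
Proof.
have rH := repr_pencil ev_s3iP repr_X4 (repr_F3 ev_s3iP).
have ck : quartic_check (4 * 4)
    (tab (4 * 4) (4 * 4) (fpencil 3 4 x4 (fF3 Qs3i))) t4.
  by vm_compute.
have HQ := quartic_checkP ev_s3iP (repr_tab rH) ck.
apply: (psd_of_quartic HQ); last exact: t4_gt0.
by apply: tens_hermitian; [exact: Xof_hermitian C4_sym | exact: F3_hermitian].
Qed.

Lemma X4_witness_not_psd :
  ~ psd (1%:M - \sum_j X4 R j *t Xof (witness_block R) j).
Proof.
set M := 1%:M - _; case=> _.
pose v : 'cV[C]_(4 * 4) := \col_i ev_s3i (test_vec i 0).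
have rv : repr ev_s3i v test_vec by move=> i j; rewrite mxE.
(* The test vector is rational, so its adjoint is the transpose and has a representation. *)
have vE : adj v = v^T.
  apply/matrixP => i j; rewrite !mxE -[LHS]/(Num.conj _).
  have rR a : Num.conj (ev_s3i ((a, 0#1), (0#1, 0#1))) =
      ev_s3i ((a, 0#1), (0#1, 0#1)).
    rewrite /ev_s3i /ev_s3 /quad_ev /= !evQ0 !mul0r !addr0 mul0r addr0.
    exact: conj_evQ.
  rewrite /test_vec -[n0 Qs3i]/((fun a => ((a, 0#1), (0#1, 0#1)) : Qs3i) (0#1)).
  case: (ltnP j 16) => [lt|]; last by rewrite leqNgt ltn_ord.
  by rewrite (nth_map (0#1)) ?rR.
have rvT : repr ev_s3i v^T (fun i j => test_vec j i).
  by move=> i j; rewrite mxE rv ord1.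
move/(_ v); rewrite vE.
have rI : repr ev_s3i (1%:M : 'M[C]_(4 * 4)) (fscalar (n1 Qs3i)).
  by apply: (repr_scalar ev_s3iP); rewrite (ev1 ev_s3iP).
have rM : repr ev_s3i M _ :=
  repr_sub ev_s3iP rI (repr_pencil ev_s3iP repr_X4 repr_y4).
have rq := repr_mul ev_s3iP (repr_mul ev_s3iP rvT rM) rv.
have -> : (v^T *m M *m v) 0 0 = ev_s3i test_value.
  have -> : v^T *m M *m v = (ev_s3i test_value)%:M.
    have rt : repr ev_s3i ((ev_s3i test_value)%:M : 'M[C]_1)
        (fscalar test_value).
      exact: (repr_scalar ev_s3iP).
    have := feq0P ev_s3iP (repr_sub ev_s3iP rq rt).
    by move/(_ ltac:(vm_compute; reflexivity))/eqP; rewrite subr_eq0 => /eqP.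
  by rewrite mxE eqxx mulr1n.
move=> q0; suff lt0 : ev_s3i test_value < 0.
  by have := lt_le_trans lt0 q0; rewrite ltxx.
rewrite /ev_s3i /ev_s3 /quad_ev /=; eval_Q; rewrite ?(mul0r, addr0, divr1).
have -> : 51 / 2 + - 91 / 6 * rc (s3 R) = rc (51 / 2 - 91 / 6 * s3 R).
  by rewrite !(rcM, rcD, rcN, rcV, rc1, rcn); field.
have s3q : s3 R ^+ 2 = 3 by rewrite sqr_sqrtr ?ler0n.
have s1 := real_sqrt3.
by rewrite ltcE /= eqxx /=; nra.
Qed.

End Instances.

Theorem mainTheorem7 (R : realType) :
  let D := spectrahedron (F3 R) in
  (D (2 + 2)%N (X4 R) /\ free_extreme D (X4 R)) /\
  (D (3 + 3)%N (X6 R) /\ free_extreme D (X6 R)) /\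
  first_level_is D (@closed_ball3 R) /\
  ~ is_min_over D (@closed_ball3 R) /\
  ~ is_max_over (matrix_range (F3 R)) (@closed_ball3 R).
Proof.
split; first exact: X4_free_extreme.
split; first exact: X6_free_extreme.
split; first exact: first_level_F3.
split; first exact: (free_extreme_not_min _ (proj2 (X4_free_extreme R))).
exact: matrix_range_not_max (X4_flip_psd R) (@X4_witness_not_psd R)
  (witness_polar R).
Qed.
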